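(* Let $\mathcal{E}:\mathcal{C}_{2n}\to\mathcal{C}_{2n}$ be a Gaussian map given by $$\mathcal{E}(X)(\theta)=C\int\exp\left[S(\theta,\eta)+i\eta^T\mu\right]X(\mu)\,D\eta\,D\mu,\qquad S(\theta,\eta)=\frac{i}{2}(\theta^T,\eta^T)\begin{pmatrix}A&B\\-B^T&D\end{pmatrix}\begin{pmatrix}\theta\\\eta\end{pmatrix},$$ with $A,B,D$ complex $2n\times2n$ matrices, $A,D$ antisymmetric, and $C\in\mathbb{C}$. Let $X\in\mathcal{C}_{2n}$ be a Gaussian operator with $\mathrm{Tr}(X)\ne0$ and correlation matrix $M$. Then $\mathcal{E}(X)$ is a Gaussian operator, and it has correlation matrix $$\mathcal{E}(M)=B(M^{-1}+D)^{-1}B^T+A=B(I+MD)^{-1}MB^T+A,$$ while its pre-exponential factor can be found from the identity $$\mathrm{Tr}\,\mathcal{E}(X)=C(-1)^n\,\mathrm{Pf}(M)\,\mathrm{Pf}(M^{-1}+D)\,\mathrm{Tr}(X).$$ The value of $\mathrm{Tr}\,\mathcal{E}(X)$ can be found up to a factor $\pm1$ from the regularized version $$\left(\mathrm{Tr}\,\mathcal{E}(X)\right)^2=C^2\det(I+MD)\,\left(\mathrm{Tr}\,X\right)^2 .$$ (The expressions containing $M^{-1}$ are meant for invertible $M$.) The expression for $\mathcal{E}(M)$ does not make sense if $I+MD$ is singular; in that case the Gaussian operator $\mathcal{E}(X)$ admits only a singular representation, i.e. as a limit of Gaussian operators with nonzero trace.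
   Context: $\mathcal{C}_{2n}$ is the complex unital algebra generated by Hermitian $\hat c_1,\dots,\hat c_{2n}$ with $\hat c_a\hat c_b+\hat c_b\hat c_a=2\delta_{ab}\hat I$; it is identified with the algebra of all linear operators on the $2^n$-dimensional Fock space of $n$ fermionic modes, with its usual trace (so $\mathrm{Tr}(\hat I)=2^n$ and non-trivial ordered monomials are traceless). The Grassmann representation $X(\theta)$ of $X\in\mathcal{C}_{2n}$ is the image of $X$ under the linear isomorphism from $\mathcal{C}_{2n}$ to the complex Grassmann (exterior) algebra $\mathcal{G}_{2n}$ with anticommuting generators $\theta_1,\dots,\theta_{2n}$ sending $\hat I\mapsto1$ and $\hat c_{a_1}\cdots\hat c_{a_p}\mapsto\theta_{a_1}\cdots\theta_{a_p}$ for $a_1<\dots<a_p$; $X(\mu)$ is the same polynomial in anticommuting variables $\mu_1,\dots,\mu_{2n}$. The variables $\theta_a,\eta_a,\mu_a$ ($a=1,\dots,2n$) are $6n$ mutually anticommuting Grassmann generators. $\theta^TN\theta=\sum_{a,b}N_{ab}\theta_a\theta_b$, $\eta^T\mu=\sum_a\eta_a\mu_a$, and likewise for other forms; exponentials are finite Taylor series. Partial derivatives are left derivatives: $\partial_{\theta_a}1=0$, $\partial_{\theta_a}(\theta_bf)=\delta_{ab}f-\theta_b\partial_{\theta_a}f$. Berezin integration is $\int d\theta_a=\partial/\partial\theta_a$, $\int D\theta=\int d\theta_{2n}\cdots\int d\theta_1$, so $\int D\theta\,\theta_1\cdots\theta_{2n}=1$. Gaussian map: a linear map $\mathcal{E}:\mathcal{C}_{2n}\to\mathcal{C}_{2n}$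 admitting an integral representation of the displayed form for some complex $2n\times2n$ matrices $A,B,D$ ($A,D$ may be and are taken antisymmetric) and some complex number $C$. Gaussian operator: an operator $X$ with $\mathrm{Tr}(X)\ne0$ is Gaussian iff $X(\theta)=C_X\exp\left(\frac{i}{2}\theta^TM\theta\right)$ for some $C_X\in\mathbb{C}$ (the pre-exponential factor, $C_X=2^{-n}\mathrm{Tr}(X)$) and some complex antisymmetric $2n\times2n$ matrix $M$, called its correlation matrix; an operator $X$ with $\mathrm{Tr}(X)=0$ is Gaussian iff it is the limit of a converging sequence of Gaussian operators with nonzero trace (singular representation). The Pfaffian is $\mathrm{Pf}(N)=\frac{1}{2^nn!}\sum_{\sigma\in S_{2n}}\mathrm{sgn}(\sigma)N_{\sigma_1\sigma_2}\cdots N_{\sigma_{2n-1}\sigma_{2n}}$ for a complex antisymmetric $2n\times 2n$ matrix $N$. *)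

(* Defs.v *)
From HB Require Import structures.
From mathcomp Require Import all_boot all_order all_fingroup all_algebra.
From mathcomp Require Import ring.

Set Implicit Arguments.
Unset Strict Implicit.
Unset Printing Implicit Defensive.

Import Order.TTheory GRing.Theory Num.Theory.

Local Open Scope ring_scope.

(* The exterior algebra on m generators: x S is the coefficient of the         *)
(* monomial formed by the generators in S, multiplied in increasing order.     *)
Definition grassmann (K : fieldType) (m : nat) := {ffun {set 'I_m} -> K}.

Section GrassmannAlgebra.

Variables (K : fieldType) (m : nat).
Implicit Types (x y z : grassmann K m) (S T U : {set 'I_m}) (a b : 'I_m).

HB.instance Definition _ := Vector.copy (grassmann K m) {ffun {set 'I_m} -> K^o}.

(* Number of transpositions needed to sort the concatenation of the ordered    *)
(* monomials on S and T.                                                       *)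
Definition ginv S T : nat := (\sum_(a in S) \sum_(b in T) (b < a))%N.

Definition gone : grassmann K m := [ffun S : {set 'I_m} => (S == set0)%:R].

Definition gmul x y : grassmann K m :=
  [ffun S : {set 'I_m} => \sum_(T : {set 'I_m} | T \subset S)
     (-1) ^+ ginv T (S :\: T) * x T * y (S :\: T)].

Lemma ginv0l S : ginv set0 S = 0%N.
Proof. by rewrite /ginv big_set0. Qed.

Lemma ginv0r S : ginv S set0 = 0%N.
Proof. by rewrite /ginv big1 // => a _; rewrite big_set0. Qed.

Lemma ginvUl S T U : [disjoint S & T] ->
  ginv (S :|: T) U = (ginv S U + ginv T U)%N.
Proof.
by move=> d; rewrite /ginv -bigU //=; apply: eq_bigl => a; rewrite !inE.
Qed.

Lemma ginvUr S T U : [disjoint T & U] ->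
  ginv S (T :|: U) = (ginv S T + ginv S U)%N.
Proof.
move=> d; rewrite /ginv -big_split; apply: eq_bigr => a _.
by rewrite -bigU //=; apply: eq_bigl => b; rewrite !inE.
Qed.

Lemma gmulA : associative gmul.
Proof.
move=> x y z; apply/ffunP => S; rewrite !ffunE.
under eq_bigr => T _ do rewrite ffunE mulr_sumr.
under [RHS]eq_bigr => U _ do rewrite ffunE mulr_sumr mulr_suml.
rewrite [RHS](exchange_big_dep (fun T : {set 'I_m} => T \subset S)) /=; last first.
  by move=> U T sUS sTU; apply: subset_trans sTU sUS.
apply: eq_bigr => T sTS.
rewrite [RHS](reindex_onto (fun V : {set 'I_m} => T :|: V)
                     (fun U : {set 'I_m} => U :\: T)) /=; last first.
  move=> U /andP[_ sTU].
  by rewrite setDE setUIr setUCr setIT; apply/setUidPr.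
apply: eq_big => [V|V sV].
  apply/idP/idP.
    move=> sV; rewrite subUset sTS subsetUl /=.
    rewrite (subset_trans sV (subsetDl _ _)) /=.
    rewrite setDUl setDv set0U; apply/eqP; apply/setDidPl.
    by rewrite disjoint_sym disjoint_subset; apply/subsetP => i iT;
      rewrite inE; apply/negP => /(subsetP sV); rewrite inE iT.
  move=> /andP[/andP[]]; rewrite subUset => /andP[_ sVS] _ /eqP <-.
  by rewrite setDUl setDv set0U setSD.
have dTV : [disjoint T & V].
  rewrite disjoint_subset; apply/subsetP => i iT.
  by rewrite inE; apply/negP => /(subsetP sV); rewrite inE iT.
have E1 : S :\: T :\: V = S :\: (T :|: V) by rewrite setDDl.
have E2 : (T :|: V) :\: T = V.
  rewrite setDUl setDv set0U; apply/setDidPl; by rewrite disjoint_sym.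
have E3 : S :\: T = V :|: (S :\: (T :|: V)).
  rewrite -setDDl -{1}(setID (S :\: T) V).
  by congr (_ :|: _); apply/setIidPr.
rewrite E1 E2 E3.
rewrite ginvUr; last first.
  by rewrite disjoint_subset; apply/subsetP => i iV; rewrite !inE iV orbT.
rewrite ginvUl // !exprD.
set e1 := (_ ^+ ginv T V); set e2 := (_ ^+ ginv T _).
set e3 := (_ ^+ ginv V _).
ring.
Qed.

Lemma gmul1l : left_id gone gmul.
Proof.
move=> x; apply/ffunP => S; rewrite ffunE (bigD1 set0) ?sub0set //=.
rewrite ginv0l setD0 ffunE eqxx !mul1r big1 ?addr0 // => T /andP[_ /negPf T0].
by rewrite ffunE T0 mulr0 mul0r.
Qed.

Lemma gmul1r : right_id gone gmul.
Proof.
move=> x; apply/ffunP => S; rewrite ffunE (bigD1 S) //=.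
rewrite setDv ginv0r ffunE eqxx mulr1 mul1r big1 ?addr0 // => T /andP[sTS TS].
rewrite ffunE setD_eq0; case: (boolP (S \subset T)) => sST; last by rewrite mulr0.
by rewrite eqEsubset sTS sST in TS.
Qed.

Lemma gmulDl : left_distributive gmul +%R.
Proof.
move=> x y z; apply/ffunP => S; rewrite !ffunE -big_split; apply: eq_bigr.
by move=> T _; rewrite ffunE mulrDr mulrDl.
Qed.

Lemma gmulDr : right_distributive gmul +%R.
Proof.
move=> x y z; apply/ffunP => S; rewrite !ffunE -big_split; apply: eq_bigr.
by move=> T _; rewrite ffunE mulrDr.
Qed.

Lemma gone_neq0 : gone != 0.
Proof.
by apply/eqP => /ffunP/(_ set0)/eqP; rewrite !ffunE eqxx oner_eq0.
Qed.

HB.instance Definition _ := GRing.Zmodule_isNzRing.Build (grassmann K m)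
  gmulA gmul1l gmul1r gmulDl gmulDr gone_neq0.

Lemma gmulE x y S : (x * y) S = \sum_(T : {set 'I_m} | T \subset S)
  (-1) ^+ ginv T (S :\: T) * x T * y (S :\: T).
Proof. exact: ffunE. Qed.

Lemma goneE S : (1 : grassmann K m) S = (S == set0)%:R.
Proof. exact: ffunE. Qed.

Lemma gscaleE (k : K) x S : (k *: x) S = k * x S.
Proof. exact: ffunE. Qed.

Lemma goppE x S : (- x) S = - x S.
Proof. exact: ffunE. Qed.

Lemma gaddE x y S : (x + y) S = x S + y S.
Proof. exact: ffunE. Qed.

Lemma gscaleAl (k : K) x y : k *: (x * y) = (k *: x) * y.
Proof.
apply/ffunP => S; rewrite gscaleE !gmulE mulr_sumr; apply: eq_bigr => T _.
by rewrite gscaleE; ring.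
Qed.

Lemma gscaleAr (k : K) x y : k *: (x * y) = x * (k *: y).
Proof.
apply/ffunP => S; rewrite gscaleE !gmulE mulr_sumr; apply: eq_bigr => T _.
by rewrite gscaleE; ring.
Qed.

HB.instance Definition _ :=
  GRing.Lmodule_isLalgebra.Build K (grassmann K m) gscaleAl.
HB.instance Definition _ :=
  GRing.Lalgebra_isAlgebra.Build K (grassmann K m) gscaleAr.

Definition gvar a : grassmann K m := [ffun S : {set 'I_m} => (S == [set a])%:R].

(* Left derivative; see gderiv1 and gderiv_gvarM. *)
Definition gderiv a x : grassmann K m :=
  [ffun S : {set 'I_m} =>
     if a \in S then 0 else (-1) ^+ ginv [set a] S * x (a |: S)].

Lemma gvarM b x S :
  (gvar b * x) S =
  if b \in S then (-1) ^+ ginv [set b] (S :\ b) * x (S :\ b) else 0.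
Proof.
rewrite gmulE; case: ifPn => bS.
  rewrite (bigD1 [set b]) ?sub1set //= ffunE eqxx mulr1.
  rewrite big1 ?addr0 // => T /andP[_ /negPf Tb].
  by rewrite ffunE Tb mulr0 mul0r.
rewrite big1 // => T sT; rewrite ffunE; case: eqP => [E|]; last first.
  by rewrite mulr0 mul0r.
by rewrite E sub1set (negPf bS) in sT.
Qed.

Lemma gderiv1 a : gderiv a 1 = 0.
Proof.
apply/ffunP => S; rewrite ffunE [RHS]ffunE; case: ifP => // _.
rewrite goneE; case: eqP => [/setP/(_ a)|]; last by rewrite mulr0.
by rewrite !inE eqxx.
Qed.

Lemma ginv11 a b : ginv [set a] [set b] = (b < a)%N.
Proof. by rewrite /ginv !big_set1. Qed.

Lemma gderiv_gvarM a b x :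
  gderiv a (gvar b * x) = (a == b)%:R *: x - gvar b * gderiv a x.
Proof.
apply/ffunP => S.
rewrite gaddE goppE gscaleE gvarM ffunE gvarM [gderiv a x _]ffunE !inE /=.
have [<-|nab] := eqVneq a b.
  rewrite /= ?andbF; case: ifPn => aS.
    rewrite setD1K // mulrA -expr2 sqrr_sign !mul1r.
    by rewrite addrN.
  by rewrite setU1K // mulrA -expr2 sqrr_sign !mul1r oppr0 addr0.
rewrite /= mul0r add0r.
case: ifPn => aS /=; first by case: ifP; rewrite ?mulr0 oppr0.
case: ifPn => bS; last by rewrite mulr0 oppr0.
have -> : (a |: S) :\ b = a |: (S :\ b).
  by rewrite setDUl; congr (_ :|: _); apply/setDidPl; rewrite disjoints1 inE.
have eS : ginv [set a] S = (ginv [set a] [set b] + ginv [set a] (S :\ b))%N.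
  by rewrite -[in LHS](setD1K bS) ginvUr // disjoints1 !inE eqxx.
have eT : ginv [set b] (a |: (S :\ b)) =
    (ginv [set b] [set a] + ginv [set b] (S :\ b))%N.
  by rewrite ginvUr // disjoints1 !inE negb_and aS orbT.
rewrite eS eT !ginv11 !exprD.
have : (-1) ^+ (b < a)%N * (-1) ^+ (a < b)%N = -1 :> K.
  by case: ltngtP nab => [||/val_inj->]; rewrite ?eqxx ?mulr1 ?mul1r.
set u := _ ^+ _; set v := _ ^+ _; move=> uv.
rewrite [LHS](_ : _ = (u * v) * ((-1) ^+ ginv [set b] (S :\ b) *
  ((-1) ^+ ginv [set a] (S :\ b) * x (a |: S :\ b)))); last by ring.
by rewrite uv mulN1r.
Qed.

Lemma gvar_anticomm a b : gvar a * gvar b = - (gvar b * gvar a).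
Proof.
apply/ffunP => S; rewrite goppE !gvarM !ffunE.
have E c d : c \in S -> (S :\ c == [set d]) = (c != d) && (S == [set c; d]).
  move=> cS; apply/eqP/andP => [E|[cd /eqP->]].
    split; last by rewrite -(setD1K cS) E.
    by apply/negP => /eqP cd; move/setP/(_ c): E; rewrite !inE cd eqxx.
  by rewrite setU1K // inE.
have F c d : c \notin S -> (S == [set d; c]) = false.
  by move=> cS; apply/eqP => e; rewrite e !inE eqxx orbT in cS.
have [aS|aS] := boolP (a \in S); have [bS|bS] := boolP (b \in S).
- rewrite !E // (setUC [set b]) (eq_sym b).
  have [ab|ab] := eqVneq a b; first by rewrite !mulr0 oppr0.
  have [SE|] := eqVneq S [set a; b]; last by rewrite !mulr0 oppr0.
  rewrite !mulr1 SE setU1K ?inE // setUC setU1K ?inE 1?eq_sym // !ginv11.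
  by case: ltngtP ab => [||/val_inj->]; rewrite ?eqxx ?opprK.
- by rewrite E // F // andbF mulr0 oppr0.
- by rewrite E // F // andbF mulr0 oppr0.
- by rewrite oppr0.
Qed.

End GrassmannAlgebra.

Section GrassmannCalculus.

Variable K : fieldType.

(* An element without constant term is nilpotent of index at most m.+1, so     *)
(* this is its full Taylor series.                                             *)
Definition gexp (m : nat) (x : grassmann K m) : grassmann K m :=
  \sum_(k < m.+1) (k`!%:R)^-1 *: x ^+ k.

(* The polynomial x evaluated at v; the product over S is taken in increasing  *)
(* order, as \prod over ordinals always is.                                    *)
Definition gsubst (m p : nat) (v : 'I_m -> grassmann K p) (x : grassmann K m)
  : grassmann K p := \sum_(S : {set 'I_m}) x S *: \prod_(a in S) v a.

(* v^T N v *)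
Definition gquad (m p : nat) (v : 'I_p -> grassmann K m) (N : 'M[K]_p)
  : grassmann K m := \sum_a \sum_b N a b *: (v a * v b).

(* u^T v *)
Definition gdot (m p : nat) (u v : 'I_p -> grassmann K m) : grassmann K m :=
  \sum_a u a * v a.

(* Berezin integral over the variables v 0, ..., v p.-1: the derivative in v 0 *)
(* is taken first, so that the integral of v 0 * ... * v p.-1 is 1.            *)
Definition berezin (m p : nat) (v : 'I_p -> 'I_m) (x : grassmann K m)
  : grassmann K m := foldl (fun y a => gderiv (v a) y) x (enum 'I_p).

End GrassmannCalculus.

(* The 6n generators are ordered as theta, eta, mu. *)
Definition theta_eta (n : nat) (a : 'I_(n.*2 + n.*2))
  : 'I_(n.*2 + n.*2 + n.*2) := lshift n.*2 a.
Definition theta (n : nat) (a : 'I_n.*2) := theta_eta (lshift n.*2 a).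
Definition eta (n : nat) (a : 'I_n.*2) := theta_eta (rshift n.*2 a).
Definition mu (n : nat) (a : 'I_n.*2) : 'I_(n.*2 + n.*2 + n.*2) :=
  rshift (n.*2 + n.*2) a.

Lemma even_index_subproof (n : nat) (k : 'I_n) : (k.*2 < n.*2)%N.
Proof. by rewrite ltn_double. Qed.

Lemma odd_index_subproof (n : nat) (k : 'I_n) : (k.*2.+1 < n.*2)%N.
Proof. by rewrite ltn_Sdouble. Qed.

Definition Pf (K : fieldType) (n : nat) (N : 'M[K]_n.*2) : K :=
  (2 ^+ n * n`!%:R)^-1 *
  \sum_(s : 'S_(n.*2)) (-1) ^+ s *
    \prod_(k < n) N (s (Ordinal (even_index_subproof k)))
                    (s (Ordinal (odd_index_subproof k))).

Section Clifford.

Variables (K : numClosedFieldType) (n : nat).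
Implicit Types (c : 'I_n.*2 -> 'M[K]_(2 ^ n)) (X : 'M[K]_(2 ^ n)).

(* C_{2n} is the full algebra of operators on the 2^n-dimensional Fock space,  *)
(* written in an orthonormal basis.                                            *)
Definition clifford_generators c : Prop :=
  (forall a, c a \is hermsymmx) /\
  (forall a b, c a *m c b + c b *m c a = (2 * (a == b)%:R)%:M).

Definition monomial c (S : {set 'I_n.*2}) : 'M[K]_(2 ^ n) :=
  \big[mulmx/1%:M]_(a in S) c a.

(* The isomorphism from the Grassmann algebra to C_{2n} sending each ordered   *)
(* monomial in theta to the same monomial in c.                                *)
Definition quantize c (x : grassmann K n.*2) : 'M[K]_(2 ^ n) :=
  \sum_(S : {set 'I_n.*2}) x S *: monomial c S.

(* The inverse of quantize; see quantizeK and grassmann_repK. *)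
Definition grassmann_rep c X : grassmann K n.*2 :=
  ((linfun (quantize c))^-1)%VF X.

Lemma quantize_linear c : linear (quantize c).
Proof.
move=> k x y; rewrite /quantize scaler_sumr -big_split /=.
by apply: eq_bigr => S _; rewrite gaddE gscaleE scalerDl scalerA.
Qed.

HB.instance Definition _ c :=
  GRing.isLinear.Build K (grassmann K n.*2) 'M[K]_(2 ^ n) _ (quantize c)
    (quantize_linear c).

Section Bijectivity.

Variable c : 'I_n.*2 -> 'M[K]_(2 ^ n).
Hypothesis cC : clifford_generators c.

Lemma clifford_sqr a : c a *m c a = 1%:M.
Proof.
have := cC.2 a a; rewrite eqxx mulr1 => E.
have n2 : (2 : K) != 0 by rewrite pnatr_eq0.
by apply: (scalerI n2); rewrite scalemx1 -E scaler_nat mulr2n.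
Qed.

Lemma clifford_anticomm a b : a != b -> c a *m c b = - (c b *m c a).
Proof.
move=> ab; apply/eqP; rewrite -addr_eq0 cC.2 (negPf ab) mulr0.
by rewrite -scalemx1 scale0r.
Qed.

Let char (S : {set 'I_n.*2}) b : K := (-1) ^+ (#|S| + (b \in S)).

Lemma monomial_comm S b :
  c b *m monomial c S = char S b *: (monomial c S *m c b).
Proof.
rewrite /char /monomial -big_filter; set r := filter _ _.
have mem_r a : (a \in r) = (a \in S) by rewrite mem_filter mem_index_enum andbT.
have ur : uniq r by rewrite filter_uniq ?index_enum_uniq.
have -> : #|S| = size r by rewrite -(card_uniqP ur); apply: eq_card.
rewrite -mem_r; elim: r {mem_r} ur => [|a r IH] /=.
  by rewrite big_nil mulmx1 mul1mx expr0 scale1r.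
move=> /andP[ar ur]; rewrite big_cons mulmxA inE.
have [ba|ba] /= := eqVneq b a.
  move: (IH ur); rewrite ba (negPf ar) addn0 addn1 => E.
  by rewrite -[LHS]mulmxA [in LHS]E -scalemxAr mulmxA !exprS !mulN1r opprK.
rewrite clifford_anticomm // mulNmx -[X in - X]mulmxA IH // -scalemxAr -scaleNr mulmxA.
by rewrite addSn exprS mulN1r.
Qed.

Lemma monomial_unit S : monomial c S \in unitmx.
Proof.
rewrite /monomial; elim/big_ind: _ => [|A B uA uB|a _]; first exact: unitmx1.
  by rewrite unitmx_mul uA.
by case/mulmx1_unit: (clifford_sqr a).
Qed.

Lemma char_inj S T : (forall b, char S b = char T b) -> S = T.
Proof.
move=> E; have {}E b : odd #|S| (+) (b \in S) = odd #|T| (+) (b \in T).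
  have := E b; rewrite /char -signr_odd -[in RHS]signr_odd !oddD !oddb.
  move/eqP; rewrite -subr_eq0; case: (_ (+) _); case: (_ (+) _) => //=;
  by rewrite ?expr0 ?expr1 ?opprK -?opprD ?oppr_eq0 -mulr2n pnatr_eq0.
have [oST|oST] := eqVneq (odd #|S|) (odd #|T|).
  by apply/setP => b; have := E b; rewrite oST => /addbI.
have ES : S = ~: T.
  apply/setP => b; rewrite inE; have := E b; move: oST.
  by case: (odd _); case: (odd _); case: (_ \in _); case: (_ \in _).
have := cardsC T; rewrite card_ord -ES => /(congr1 odd).
by rewrite oddD odd_double; move: oST; case: (odd _); case: (odd _).
Qed.

Lemma monomial_trace S T :
  S != T -> \tr (invmx (monomial c T) *m monomial c S) = 0.
Proof.
move=> ST; case: (pickP (fun b => char S b != char T b)) => [b Hb|H]; last first.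
  by case/eqP: ST; apply: char_inj => b; move: (H b) => /negbFE/eqP.
set W := _ *m _; have TW : monomial c T *m W = monomial c S.
  by rewrite mulmxA mulmxV ?monomial_unit // mul1mx.
clearbody W; have chi2 U : char U b * char U b = 1 by rewrite -expr2 sqrr_sign.
have chiST : char T b * char S b = -1.
  move: Hb; rewrite /char -signr_odd -[X in _ != X]signr_odd.
  rewrite -[X in X * _]signr_odd -[X in _ * X]signr_odd.
  by do 2![case: (odd _)]; rewrite ?eqxx ?mulr1 ?mul1r.
have conj U : monomial c U *m c b = char U b *: (c b *m monomial c U).
  by rewrite monomial_comm scalerA chi2 scale1r.
have cWc : c b *m W *m c b = - W.
  rewrite -scaleN1r -chiST; apply: (can_inj (mulKmx (monomial_unit T))).
  rewrite -[RHS]scalemxAr TW !mulmxA conj -!scalemxAl -(mulmxA (c b)) TW.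
  by rewrite monomial_comm -scalemxAl -mulmxA clifford_sqr mulmx1 scalerA.
have : \tr W = - \tr W.
  by rewrite -raddfN /= -cWc mxtrace_mulC mulmxA clifford_sqr mul1mx //.
by move/eqP; rewrite -addr_eq0 -mulr2n mulrn_eq0 /= => /eqP.
Qed.

Lemma quantize_inj : injective (quantize c).
Proof.
apply: raddf_inj => x; rewrite /quantize => x0; apply/ffunP => T.
rewrite [RHS]ffunE; have := congr1 (fun A => \tr (invmx (monomial c T) *m A)) x0.
rewrite mulmx0 mxtrace0 mulmx_sumr raddf_sum /= (bigD1 T) //=.
rewrite -scalemxAr mulVmx ?monomial_unit // mxtraceZ mxtrace1.
rewrite big1 ?addr0; last first.
  by move=> S ST; rewrite -scalemxAr mxtraceZ monomial_trace // mulr0.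
by move/eqP; rewrite mulf_eq0 pnatr_eq0 expn_eq0 orbF => /eqP.
Qed.

Lemma quantize_lker0 : lker (linfun (quantize c)) == 0%VS.
Proof. by apply/lker0P => x y; rewrite !lfunE /= => /quantize_inj. Qed.

Lemma grassmann_repK x : grassmann_rep c (quantize c x) = x.
Proof. by have := lker0_lfunK quantize_lker0 x; rewrite lfunE. Qed.

Lemma quantizeK X : quantize c (grassmann_rep c X) = X.
Proof.
have full : limg (linfun (quantize c)) = fullv.
  apply/eqP; rewrite eqEdim subvf limg_dim_eq ?(eqP quantize_lker0) ?capv0 //.
  rewrite !dimvf /dim /= muln1 -cardsT -powersetT card_powerset cardsT card_ord.
  by rewrite -expnD addnn.
have := @limg_lfunVK _ _ _ (linfun (quantize c)) X.
by rewrite full memvf lfunE => ->.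
Qed.

End Bijectivity.

End Clifford.

From mathcomp Require Import all_classical all_reals all_analysis.
Import numFieldNormedType.Exports.

Section Gaussian.

Variables (K : numClosedFieldType) (n : nat).
Implicit Types (c : 'I_n.*2 -> 'M[K]_(2 ^ n)) (X : 'M[K]_(2 ^ n)).
Implicit Types (A B D M : 'M[K]_n.*2).

Definition antisymmetric_mx M : Prop := M^T = - M.

(* X(theta) = CX exp(i/2 theta^T M theta) *)
Definition gaussian_form c X (CX : K) M : Prop :=
  antisymmetric_mx M /\
  grassmann_rep c X = CX *: gexp ('i / 2 *: gquad (@gvar K n.*2) M).

Definition regular_gaussian c X : Prop :=
  \tr X != 0 /\ exists CX M, gaussian_form c X CX M.

Definition singular_gaussian c X : Prop :=
  \tr X = 0 /\
  exists u : nat -> 'M[K]_(2 ^ n),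
    (forall k, regular_gaussian c (u k)) /\ (u @ \oo --> X)%classic.

Definition gaussian c X : Prop := regular_gaussian c X \/ singular_gaussian c X.

Definition gaussian_action A B D : grassmann K (n.*2 + n.*2 + n.*2) :=
  'i / 2 *: gquad (fun a => gvar K (theta_eta a)) (block_mx A B (- B^T) D).

(* Both sides live in the algebra on all 6n generators. The integral           *)
(* D eta D mu does not depend on the order of D eta and D mu, which are        *)
(* operators of even degree 2n.                                                *)
Definition gaussian_integral_rep c (E : 'M[K]_(2 ^ n) -> 'M[K]_(2 ^ n))
    A B D (C : K) : Prop :=
  forall X,
    gsubst (fun a => gvar K (theta a)) (grassmann_rep c (E X)) =
    C *: berezin (@eta n) (berezin (@mu n)
      (gexp (gaussian_action A B D +
             'i *: gdot (fun a => gvar K (eta a)) (fun a => gvar K (mu a))) *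
       gsubst (fun a => gvar K (mu a)) (grassmann_rep c X))).

End Gaussian.

(* Main.v *)
From HB Require Import structures.
Require Import Defs.
From mathcomp Require Import all_boot all_order all_fingroup all_algebra.
From mathcomp Require Import ring.

Set Implicit Arguments.
Unset Strict Implicit.
Unset Printing Implicit Defensive.

Import Order.TTheory GRing.Theory Num.Theory.
Local Open Scope ring_scope.

(* A Grassmann element x is a multiple of exp(q), with q quadratic, as soon as *)
(* d_a x = (d_a q) x for every generator a. Let W be the integrand and write   *)
(* <f> for the integral of f W. Integrals of derivatives vanish, so            *)
(* integrating dW/deta and dW/dmu gives <eta> = M <mu> and                     *)
(* <mu> + D <eta> = B^T theta <1>; hence (1 + MD) <eta> = M B^T theta <1> and  *)
(* d<1>/dtheta = i (A theta <1> + B <eta>), which identifies the correlation   *)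
(* matrix. The constant term of <1> is the top coefficient of a Gaussian in    *)
(* the 4n variables (eta, mu), that is, up to the sign (-1)^n, the Pfaffian of *)
(* T = [[D, 1], [-1, M]], and det T = det (1 + MD). A linear substitution      *)
(* multiplies top coefficients by its determinant: block elimination in T      *)
(* gives Pf(T) = Pf(M) Pf(M^-1 + D), and Pf(N)^2 = det N follows by comparing  *)
(* diag(N, N) with [[0, N], [N, 0]]. If 1 + MD is singular, replace M by t M   *)
(* and let t tend to 1: det (1 + t MD) is a nonzero polynomial in t, and the   *)
(* image of the perturbed operator is polynomial in t.                         *)

(** * Anticommuting families *)

(** Gaussian elements are the solutions of a first-order linear system: by [gexp_unique], an element
    whose derivatives are those of a quadratic q times the element itself is a multiple of exp(q).
    For the Gaussian integral this system comes from the vanishing of integrated derivatives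
    ([gderivs_gderiv0]). It gives linear relations between the moments of theta, eta and mu
    ([schwinger_dyson_mu], [schwinger_dyson_eta]), and solving them when I + MD is invertible yields
    [gaussian_integral_form].

    The trace of the output is the constant term of the integral up to the factor 2^n, and
    [gaussian_integral_const] identifies that term with a Pfaffian of [transfer_mx]. The Pfaffian
    identities rest on one principle, [gsubst_glin_top]: a linear substitution multiplies the top
    coefficient by its determinant. Hence the congruence rule [gpf_congr], and from it the square
    [gpf_sqr] and the factorization [gpf_transfer]; [Pf_gpf] connects top coefficients with the sum
    over permutations.

    An output of trace zero is reached in [gaussian_map_zero_trace_singular] by rescaling M: the
    determinant of I + tMD is a nonzero polynomial in t ([det_perturbation]), and the output is
    polynomial in t, hence continuous. *)

Section AnticommutingFamilies.

(** In a general ring, anticommutation only makes twice each square vanish, so the squares are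
    treated separately. *)
Definition anticommuting (I : Type) (A : nzRingType) (v : I -> A) : Prop :=
  (forall a, v a * v a = 0) /\ (forall a b, v a * v b = - (v b * v a)).

Definition ord_lt m : rel 'I_m := fun a b => (a < b)%N.

Lemma ord_lt_trans m : transitive (@ord_lt m).
Proof. by move=> b a c; apply: ltn_trans. Qed.

Lemma sorted_index_enum m : sorted (@ord_lt m) (index_enum 'I_m).
Proof.
have -> : index_enum 'I_m = enum 'I_m by rewrite enumT.
have := iota_ltn_sorted 0 m; rewrite -val_enum_ord sorted_map.
exact: sub_sorted.
Qed.

(* The sign e and the word s' do not depend on the anticommuting family, so   *)
(* this transports the rules of computation from one family to another.       *)
Lemma insert_anticommuting m (a : 'I_m) (s : seq 'I_m) : sorted (@ord_lt m) s ->
  exists e : int, exists s' : seq 'I_m,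
    [/\ sorted (@ord_lt m) s',
        forall x, ord_lt x a -> path (@ord_lt m) x s -> path (@ord_lt m) x s' &
        forall (A : nzRingType) (v : 'I_m -> A), anticommuting v ->
          v a * \prod_(b <- s) v b = (\prod_(b <- s') v b) *~ e].
Proof.
elim: s => [_|b s IH /= pbs].
  by exists 1, [:: a]; split => // [x /= ->|A v _] //; rewrite big_seq1 big_nil mulr1.
case: (ltngtP a b) => [ab|ba|/val_inj ab].
- exists 1, [:: a, b & s]; split => [|x /= -> /andP[_ ->]|A v _] /=.
  + by rewrite /ord_lt ab.
  + by rewrite /ord_lt ab.
  + by rewrite !big_cons.
- have [e [s' [ss' ps' E]]] := IH (path_sorted pbs).
  exists (- e), (b :: s'); split => [|x /= xa /andP[xb p]|A v av] /=.
  + exact: ps'.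
  + by rewrite xb ps'.
  + by rewrite !big_cons mulrA av.2 mulNr -mulrA E // mulrzAr mulrNz.
(* A repeated factor kills the product; this is encoded by the multiplicity 0. *)
- exists 0, [::]; split => // A v av.
  by rewrite ab big_cons mulrA av.1 mul0r.
Qed.

Variables (I : Type) (A : nzRingType) (v : I -> A).
Hypothesis av : anticommuting v.

Lemma anticommuting_prod a (s : seq I) :
  v a * \prod_(b <- s) v b = (-1) ^+ size s * ((\prod_(b <- s) v b) * v a).
Proof.
elim: s => [|b s IH]; first by rewrite big_nil mulr1 !mul1r.
rewrite !big_cons mulrA av.2 mulNr -[v b * v a * _]mulrA IH /= exprS mulN1r.
by rewrite mulrA commr_sign mulNr -!mulrA.
Qed.

Lemma prod_repeat_eq0 a (s1 s2 s3 : seq I) :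
  \prod_(b <- s1 ++ a :: s2 ++ a :: s3) v b = 0.
Proof.
rewrite big_cat big_cons big_cat big_cons /=.
rewrite [X in _ * X]mulrA anticommuting_prod -!mulrA (mulrA (v a)) av.1.
by rewrite mul0r !mulr0.
Qed.

Lemma prod_swap a b (s1 s2 s3 : seq I) :
  \prod_(x <- s1 ++ a :: s2 ++ b :: s3) v x =
  - \prod_(x <- s1 ++ b :: s2 ++ a :: s3) v x.
Proof.
rewrite !(big_cat, big_cons) /= -mulrN; congr (_ * _).
have E c d y : v c * ((\prod_(x <- s2) v x) * (v d * y)) =
    (-1) ^+ size s2 * ((\prod_(x <- s2) v x) * (v c * v d * y)).
  by rewrite mulrA anticommuting_prod -!mulrA.
by rewrite !E (av.2 a) mulNr !mulrN.
Qed.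

End AnticommutingFamilies.

Section AnticommutingPerm.

Variables (m : nat) (A : nzRingType).
Implicit Types v : 'I_m -> A.

Lemma split_two (T : eqType) (s : seq T) (i j : T) :
  i != j -> i \in s -> j \in s -> exists s1 s2 s3 : seq T,
    s = s1 ++ i :: s2 ++ j :: s3 \/ s = s1 ++ j :: s2 ++ i :: s3.
Proof.
move=> ij /splitPr ei; case: ei => s1 s2.
rewrite mem_cat inE eq_sym (negPf ij) /=; case/orP => /splitPr ej.
  by case: ej => p1 p2; exists p1, p2, s2; right; rewrite -catA.
by case: ej => p1 p2; exists s1, p1, p2; left.
Qed.

Lemma prod_noninjective v (f : 'I_m -> 'I_m) : anticommuting v ->
  ~~ injectiveb f -> \prod_(a < m) v (f a) = 0.
Proof.
move=> av /injectivePn[i [j ij eqf]].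
have [s1 [s2 [s3 E]]] := split_two ij (mem_index_enum i) (mem_index_enum j).
rewrite -(big_map f predT v); case: E => ->; rewrite !(map_cat, map_cons) eqf;
exact: prod_repeat_eq0.
Qed.

Lemma prod_tperm v (i j : 'I_m) : anticommuting v -> i != j ->
  \prod_(a < m) v (tperm i j a) = - \prod_(a < m) v a.
Proof.
move=> av ij; rewrite -(big_map (tperm i j) predT v).
have tD s : i \notin s -> j \notin s -> map (tperm i j) s = s.
  move=> is' js'; rewrite -[RHS]map_id; apply/eq_in_map => x xs.
  by rewrite tpermD //; [apply: contraNneq is' => -> | apply: contraNneq js' => ->].
have [s1 [s2 [s3 E]]] := split_two ij (mem_index_enum i) (mem_index_enum j).
wlog E1 : i j ij tD E / index_enum 'I_m = s1 ++ i :: s2 ++ j :: s3.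
  case: (E) => E' wl; first exact: (wl i j).
  rewrite tpermC; apply: (wl j i) => //; first by rewrite eq_sym.
    by move=> s js is'; rewrite tpermC tD.
  by case: E; [right | left].
have := index_enum_uniq 'I_m; rewrite E1 => U.
have /and5P[i1 i2 i3 j1 /andP[j2 j3]] : [&& i \notin s1, i \notin s2,
    i \notin s3, j \notin s1, j \notin s2 & j \notin s3].
  (* The enumeration has no duplicates, so counting occurrences keeps [i] and [j] out of the three
     remaining segments. *)
  have cnt x := leq_b1 (x \in s1 ++ i :: s2 ++ j :: s3).
  move: (cnt i) (cnt j); rewrite -!count_uniq_mem // !(count_cat, eqxx) /=.
  rewrite !count_cat /= !eqxx -!has_pred1 !has_count -!leqNgt.
  do 6!move: (count_mem _ _).
  by do 6!case=> [|?]; rewrite ?(addnS, addSn).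
rewrite !(map_cat, map_cons) !tD // tpermL tpermR.
exact: prod_swap.
Qed.

Lemma prod_perm v (s : 'S_m) : anticommuting v ->
  \prod_(a < m) v (s a) = (-1) ^+ s * \prod_(a < m) v a.
Proof.
have [ts -> dts] := prod_tpermP s.
elim: ts dts v => [|[i j] ts IH] /= => [_ v _|/andP[ij dts] v av].
  by rewrite big_nil odd_perm1 mul1r; apply: eq_bigr => a _; rewrite perm1.
rewrite big_cons; set t := (\prod_(p <- ts) _)%g in IH *.
under eq_bigr do rewrite permM.
have avt : anticommuting (v \o t) by split => *; rewrite /= ?av.1 // av.2.
rewrite -[LHS]/(\prod_(a < m) (v \o t) (tperm i j a)) prod_tperm //.
by rewrite IH // odd_mul_tperm ij /= signrN mulNr.
Qed.

End AnticommutingPerm.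

(** * Degrees, derivatives and monomials *)

Section Degree.

Variables (K : fieldType) (m : nat).
Implicit Types (x y : grassmann K m) (S T : {set 'I_m}) (P Q R : pred nat).

(** With [pred1 d] this is homogeneity of degree [d]; with [leq d] it says that all terms have
    degree at least [d]. *)
Definition gdeg P x : Prop := forall S, x S != 0 -> P #|S|.

Lemma gdegW P Q x : subpred P Q -> gdeg P x -> gdeg Q x.
Proof. by move=> PQ Px S /Px/PQ. Qed.

Lemma gdeg0 P : gdeg P 0.
Proof. by move=> S; rewrite ffunE eqxx. Qed.

Lemma gdegD P x y : gdeg P x -> gdeg P y -> gdeg P (x + y).
Proof.
move=> Px Py S; rewrite gaddE; have [->|/Px //] := eqVneq (x S) 0.
by rewrite add0r => /Py.
Qed.

Lemma gdegZ P k x : gdeg P x -> gdeg P (k *: x).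
Proof. by move=> Px S; rewrite gscaleE mulf_eq0 negb_or => /andP[_ /Px]. Qed.

Lemma gdeg_sum P I (r : seq I) (C : pred I) (F : I -> grassmann K m) :
  (forall i, C i -> gdeg P (F i)) -> gdeg P (\sum_(i <- r | C i) F i).
Proof. by move=> FP; apply: big_ind => //; [apply: gdeg0 | apply: gdegD]. Qed.

Lemma gdegM P Q R x y : (forall d e, P d -> Q e -> R (d + e)%N) ->
  gdeg P x -> gdeg Q y -> gdeg R (x * y).
Proof.
move=> PQR Px Qy S; rewrite gmulE; apply: contraR => nR.
rewrite big1 // => T sTS; apply/eqP; apply: contraR nR.
rewrite !mulf_eq0 !negb_or -andbA => /and3P[_ /Px PT /Qy QT].
by rewrite -(setID S T) (setIidPr sTS) cardsU setIDA setIC setDIl setDv setI0 cards0 subn0 PQR.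
Qed.

Lemma gdeg1 : gdeg (pred1 0%N) 1.
Proof. by move=> S; rewrite goneE; case: (S =P set0) => [->|_]; rewrite ?eqxx ?cards0. Qed.

Lemma gdeg_gvar a : gdeg (pred1 1%N) (gvar K a).
Proof.
by move=> S; rewrite ffunE; case: (S =P _) => [->|_]; rewrite ?eqxx ?cards1.
Qed.

Lemma gdegX d k x : gdeg (pred1 d) x -> gdeg (pred1 (k * d)%N) (x ^+ k).
Proof.
move=> dx; elim: k => [|k IH]; first exact: gdeg1.
by rewrite exprS; apply: gdegM dx IH => _ _ /eqP-> /eqP->; rewrite mulSn /= eqxx.
Qed.

Lemma gdeg_prod I (r : seq I) (C : pred I) (F : I -> grassmann K m) :
  (forall i, C i -> gdeg (pred1 1%N) (F i)) ->
  gdeg (pred1 (\sum_(i <- r | C i) 1)%N) (\prod_(i <- r | C i) F i).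
Proof.
move=> FP; elim: r => [|i r IH]; first by rewrite !big_nil; apply: gdeg1.
rewrite !big_cons; case: ifP => // /FP iP.
by apply: gdegM iP IH => _ _ /eqP-> /eqP->; rewrite /= eqxx.
Qed.

Lemma gdeg_eq0 P x : (forall d, (d <= m)%N -> ~~ P d) -> gdeg P x -> x = 0.
Proof.
move=> nP Px; apply/ffunP => S; rewrite [RHS]ffunE; apply/eqP.
have := max_card (mem S); rewrite card_ord => /nP.
by apply: contraNT => /Px.
Qed.

Lemma gderiv_is_linear a : linear (@gderiv K m a).
Proof.
move=> k x y; apply/ffunP => S; rewrite gaddE gscaleE ![gderiv _ _ S]ffunE.
by case: ifP => _; rewrite ?mulr0 ?addr0 // gaddE gscaleE; ring.
Qed.

HB.instance Definition _ a :=
  GRing.isLinear.Build K (grassmann K m) (grassmann K m) _ (@gderiv K m a)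
    (gderiv_is_linear a).

Lemma gdeg_gderiv d a x : gdeg (leq d.+1) x -> gdeg (leq d) (gderiv a x).
Proof.
move=> dx S; rewrite ffunE; case: ifPn => [|aS]; first by rewrite eqxx.
by rewrite mulf_eq0 negb_or => /andP[_ /dx]; rewrite cardsU1 aS.
Qed.

(** A nonempty monomial S contains some [a], and the derivative in [a] carries the coefficient of S,
    up to sign, at S without [a]. *)
Lemma gdeg_from_gderiv d x : x set0 = 0 ->
  (forall a, gdeg (leq d) (gderiv a x)) -> gdeg (leq d.+1) x.
Proof.
move=> x0 dx S xS; have [S0|[a aS]] := set_0Vmem S.
  by rewrite S0 x0 eqxx in xS.
have := dx a (S :\ a); rewrite ffunE setD11 setD1K // mulf_eq0 signr_eq0 /=.
by move=> /(_ xS); rewrite (cardsD1 a S) aS.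
Qed.

(* x is recovered from its constant term and its derivatives, so a first-order *)
(* linear system determines it from its constant term.                         *)
Lemma gderiv_system_eq0 (l : 'I_m -> grassmann K m) x :
  (forall a, gdeg (leq 1) (l a)) -> x set0 = 0 ->
  (forall a, gderiv a x = l a * x) -> x = 0.
Proof.
move=> dl x0 dx; suff H d : gdeg (leq d) x.
  by apply: (@gdeg_eq0 (leq m.+1)) (H _) => d dm; rewrite -ltnNge.
(* Each pass raises the order of vanishing by one, until it exceeds the number of generators. *)
elim: d => [//|d IH]; apply: gdeg_from_gderiv => // a; rewrite dx.
by apply: gdegM (dl a) IH => d1 d2 h1 h2; apply: leq_trans h2 (leq_addl _ _).
Qed.

End Degree.

Section Monomials.

Variables (K : fieldType) (m : nat).
Implicit Types (x y : grassmann K m) (S T : {set 'I_m}).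

Lemma gvar_anticommuting : anticommuting (@gvar K m).
Proof.
split; last exact: gvar_anticomm.
move=> a; apply/ffunP => S; rewrite gvarM !ffunE; case: ifP => // aS.
case: eqP => [/setP/(_ a)|]; last by rewrite mulr0.
by rewrite !inE eqxx.
Qed.

Lemma prod_gvar_sorted (s : seq 'I_m) : sorted (@ord_lt m) s ->
  \prod_(a <- s) gvar K a = [ffun S : {set 'I_m} => (S == [set x in s])%:R].
Proof.
elim: s => [_|a s IH /= pas].
  have E : [set x in [::]] = set0 :> {set 'I_m} by apply/setP => x; rewrite !inE.
  by rewrite big_nil; apply/ffunP => S; rewrite [LHS]goneE [RHS]ffunE E.
rewrite big_cons IH ?(path_sorted pas) //; apply/ffunP => S.
have al (x : 'I_m) : x \in s -> (a < x)%N.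
  by move: pas; rewrite path_sortedE; [case/andP => /allP/(_ x) | exact: ord_lt_trans].
rewrite gvarM !ffunE; have [aS|aS] := boolP (a \in S); last first.
  by case: eqP => // E; rewrite E !inE eqxx in aS.
have -> : (S :\ a == [set x in s]) = (S == [set x in a :: s]).
  apply/eqP/eqP => [E|->]; first by rewrite -(setD1K aS) E; apply/setP => x; rewrite !inE.
  apply/setP => x; rewrite !inE; have [-> /=|//] := eqVneq x a.
  by apply/esym/negP => /al; rewrite ltnn.
case: eqP => [->|]; last by rewrite mulr0.
rewrite mulr1 /ginv big_set1 big1 ?expr0 // => x.
by rewrite !inE => /andP[/negPf-> /= /al]; rewrite ltnNge leq_eqVlt negb_or => /andP[_ /negPf->].
Qed.

Definition set_word S : seq 'I_m := [seq a <- index_enum 'I_m | a \in S].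

Lemma sorted_set_word S : sorted (@ord_lt m) (set_word S).
Proof. by apply: sorted_filter; [apply: ord_lt_trans | apply: sorted_index_enum]. Qed.

Lemma set_wordK S : [set x in set_word S] = S.
Proof. by apply/setP => x; rewrite inE mem_filter mem_index_enum andbT. Qed.

Lemma set_word_sorted (s : seq 'I_m) : sorted (@ord_lt m) s ->
  set_word [set x in s] = s.
Proof.
move=> ss; apply: (@irr_sorted_eq _ (@ord_lt m)) => //.
- exact: ord_lt_trans.
- by move=> a; rewrite /ord_lt ltnn.
- exact: sorted_set_word.
- by move=> x; rewrite mem_filter mem_index_enum inE andbT.
Qed.

Lemma prod_gvar S : \prod_(a in S) gvar K a = [ffun T : {set 'I_m} => (T == S)%:R].
Proof.
rewrite -big_filter prod_gvar_sorted ?sorted_set_word //.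
by apply/ffunP => T; rewrite !ffunE set_wordK.
Qed.

Lemma gdecomp x : x = \sum_(S : {set 'I_m}) x S *: \prod_(a in S) gvar K a.
Proof.
apply/ffunP => T; rewrite sum_ffunE (bigD1 T) //= gscaleE prod_gvar ffunE eqxx.
rewrite mulr1 big1 ?addr0 // => S ST; rewrite gscaleE prod_gvar ffunE eq_sym.
by rewrite (negPf ST) mulr0.
Qed.

(** Both generators pick up the same sign when they cross a monomial, and the two signs cancel. *)
Lemma central_gvarM a b x : gvar K a * gvar K b * x = x * (gvar K a * gvar K b).
Proof.
rewrite (gdecomp x) mulr_sumr mulr_suml; apply: eq_bigr => S _.
rewrite -scalerAl -scalerAr; congr (_ *: _).
have av := gvar_anticommuting; rewrite -big_filter -mulrA.
rewrite (anticommuting_prod av b) mulrA commr_sign -mulrA.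
rewrite [gvar K a * (_ * _)]mulrA (anticommuting_prod av a) -!mulrA.
exact: signrMK.
Qed.

End Monomials.

(** * Substitutions *)

Lemma prod_set_word m (A : nzRingType) (S : {set 'I_m}) (F : 'I_m -> A) :
  \prod_(a in S) F a = \prod_(a <- set_word S) F a.
Proof. by rewrite big_filter. Qed.

Section Substitution.

Variables (K : fieldType) (m p : nat) (v : 'I_m -> grassmann K p).
Implicit Types (x y : grassmann K m) (S T : {set 'I_m}).

Lemma gsubst_is_linear : linear (gsubst v).
Proof.
move=> k x y; rewrite /gsubst scaler_sumr -big_split /=.
by apply: eq_bigr => S _; rewrite gaddE gscaleE scalerDl scalerA.
Qed.

HB.instance Definition _ :=
  GRing.isLinear.Build K (grassmann K m) (grassmann K p) _ (gsubst v)
    gsubst_is_linear.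

Lemma gsubst_sorted (s : seq 'I_m) : sorted (@ord_lt m) s ->
  gsubst v (\prod_(a <- s) gvar K a) = \prod_(a <- s) v a.
Proof.
move=> ss; rewrite prod_gvar_sorted // /gsubst (bigD1 [set x in s]) //=.
rewrite ffunE eqxx scale1r [X in _ + X]big1 ?addr0 => [|S /negPf Ss].
  by rewrite -big_filter -/(set_word _) set_word_sorted.
by rewrite ffunE Ss scale0r.
Qed.

Lemma gsubst1 : gsubst v 1 = 1.
Proof. by have := @gsubst_sorted [::] isT; rewrite !big_nil. Qed.

Lemma gsubst_gvar a : gsubst v (gvar K a) = v a.
Proof. by have := @gsubst_sorted [:: a] isT; rewrite !big_seq1. Qed.

Hypothesis av : anticommuting v.

(** Sorting a word of generators and sorting the word of their images produce the same sign and the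
    same word, by [insert_anticommuting]. *)
Lemma gsubst_gvarM a x : gsubst v (gvar K a * x) = v a * gsubst v x.
Proof.
rewrite (gdecomp x) mulr_sumr !linear_sum mulr_sumr; apply: eq_bigr => S _.
rewrite -scalerAr !linearZ /= -scalerAr; congr (_ *: _).
rewrite !prod_set_word; have ss := sorted_set_word S.
have [e [s' [ss' _ E]]] := insert_anticommuting a ss.
rewrite E; last exact: gvar_anticommuting.
by rewrite gsubst_sorted // E // raddfMz /= gsubst_sorted.
Qed.

Lemma gsubstM : {morph gsubst v : x y / x * y}.
Proof.
move=> x y; rewrite (gdecomp x) mulr_suml !linear_sum mulr_suml.
apply: eq_bigr => S _; rewrite -scalerAl !linearZ /= -scalerAl; congr (_ *: _).
rewrite !prod_set_word gsubst_sorted ?sorted_set_word //.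
elim: (set_word S) => [|a s IH]; first by rewrite !big_nil !mul1r.
by rewrite !big_cons -!mulrA gsubst_gvarM IH.
Qed.

Lemma gsubstX x k : gsubst v (x ^+ k) = gsubst v x ^+ k.
Proof. by elim: k => [|k IH]; rewrite ?gsubst1 // !exprS gsubstM IH. Qed.

Lemma gsubst_prod I (r : seq I) (P : pred I) (F : I -> grassmann K m) :
  gsubst v (\prod_(i <- r | P i) F i) = \prod_(i <- r | P i) gsubst v (F i).
Proof. by apply: big_morph; [apply: gsubstM | apply: gsubst1]. Qed.

End Substitution.

Lemma gsubst_comp (K : fieldType) m p q (v : 'I_m -> grassmann K p)
    (w : 'I_p -> grassmann K q) x : anticommuting w ->
  gsubst w (gsubst v x) = gsubst (fun a => gsubst w (v a)) x.
Proof.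
move=> aw; rewrite [gsubst v x]/gsubst linear_sum; apply: eq_bigr => S _.
by rewrite linearZ /= gsubst_prod.
Qed.

Lemma eq_gsubst (K : fieldType) m p (v w : 'I_m -> grassmann K p) x :
  v =1 w -> gsubst v x = gsubst w x.
Proof.
move=> vw; apply: eq_bigr => S _; congr (_ *: _); apply: eq_bigr => a _.
exact: vw.
Qed.

Lemma gsubst_id (K : fieldType) m (x : grassmann K m) : gsubst (@gvar K m) x = x.
Proof. exact/esym/gdecomp. Qed.

(** * Linear substitutions and determinants *)

Section LinearSubstitution.

Variables (K : fieldType) (m : nat).

Definition glin p (Q : 'M[K]_(m, p)) a : grassmann K p := \sum_b Q a b *: gvar K b.

Lemma glin_anticommuting p (Q : 'M[K]_(m, p)) : (2 : K) != 0 -> anticommuting (glin Q).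
Proof.
move=> n2; have ac a b : glin Q a * glin Q b = - (glin Q b * glin Q a).
  rewrite /glin !mulr_suml -sumrN.
  under eq_bigr do rewrite mulr_sumr.
  under [RHS]eq_bigr do rewrite mulr_sumr -sumrN.
  rewrite exchange_big /=; apply: eq_bigr => c _; apply: eq_bigr => d _.
  by rewrite -!scalerAl -!scalerAr gvar_anticomm !scalerN !scalerA mulrC.
split=> // a; apply/eqP; have := ac a a; move/eqP; rewrite -addr_eq0.
by rewrite -mulr2n -scaler_nat scaler_eq0 (negPf n2).
Qed.

Lemma gdeg_glin p (Q : 'M[K]_(m, p)) a : gdeg (pred1 1%N) (glin Q a).
Proof. by apply: gdeg_sum => b _; apply/gdegZ/gdeg_gvar. Qed.

(** This is the Leibniz formula: after expansion the noninjective choices vanish, and [prod_perm]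
    supplies the signs of the permutations. *)
Lemma prod_glin (Q : 'M[K]_m) : \prod_a glin Q a = \det Q *: \prod_a gvar K a.
Proof.
rewrite /glin bigA_distr_bigA /=.
have sE f : \prod_i (Q i (f i) *: gvar K (f i)) =
    (\prod_i Q i (f i)) *: \prod_i gvar K (f i) by exact: scaler_prod.
under eq_bigr do rewrite sE.
rewrite (bigID (fun f : {ffun 'I_m -> 'I_m} => injectiveb f)) /=.
rewrite addrC big1 ?add0r => [|f nf]; last first.
  by rewrite (prod_noninjective (gvar_anticommuting K m) nf) scaler0.
rewrite (reindex (@pval _)) /=; last first.
  pose in_Sn := insubd (1%g : 'S_m).
  by exists in_Sn => /= f Uf;
    [apply: val_inj; apply: insubdK; apply: (valP f) | apply: insubdK].
rewrite /determinant scaler_suml; apply: eq_big => [s|s _]; first exact: (valP s).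
under [X in X *: _]eq_bigr do rewrite pvalE.
under [X in _ *: X]eq_bigr do rewrite pvalE.
rewrite (prod_perm s (gvar_anticommuting K m)) !mulr_sign.
by case: (s : bool); rewrite // scalerN scaleNr.
Qed.

(** Linear substitutions preserve degree, so only the full monomial contributes to the top
    coefficient. *)
Lemma gsubst_glin_top (Q : 'M[K]_m) x : (gsubst (glin Q) x) setT = \det Q * x setT.
Proof.
have prodT (v : 'I_m -> grassmann K m) : \prod_(a in setT) v a = \prod_a v a.
  by apply: eq_bigl => a; rewrite inE.
rewrite /gsubst sum_ffunE (bigD1 setT) //= [X in _ + X]big1 ?addr0 => [|S ST].
  rewrite gscaleE mulrC; congr (_ * _).
  have -> : \prod_(a in setT) glin Q a = \det Q *: \prod_(a in setT) gvar K a.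
    by rewrite !prodT prod_glin.
  by rewrite gscaleE prod_gvar ffunE eqxx mulr1.
rewrite gscaleE; apply/eqP; rewrite mulf_eq0; apply/orP; right.
have := @gdeg_prod K m _ (index_enum _) [in S] (glin Q) (fun a _ => @gdeg_glin _ Q a).
move/(_ setT); case: eqP => // _ /(_ isT) /=; rewrite sum1_card => /eqP cS.
by case/negP: ST; rewrite eqEcard subsetT cS /=.
Qed.

End LinearSubstitution.

(** * Exponentials of quadratic elements *)

Section Exponential.

Variables (K : numFieldType) (m : nat).
Implicit Types (q x y : grassmann K m) (a b : 'I_m).

(* The properties of elements of even degree that matter here.                 *)
Definition even_elt q : Prop :=
  (forall y, q * y = y * q) /\
  (forall a y, gderiv a (q * y) = gderiv a q * y + q * gderiv a y).

Lemma even1 : even_elt 1.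
Proof. by split=> [y|a y]; rewrite ?gderiv1 ?mul1r ?mulr1 ?mul0r ?add0r. Qed.

Lemma even0 : even_elt 0.
Proof. by split=> [y|a y]; rewrite ?mul0r ?mulr0 // !linear0 mul0r addr0. Qed.

Lemma evenD x y : even_elt x -> even_elt y -> even_elt (x + y).
Proof.
move=> [cx dx] [cy dy]; split=> [z|a z]; first by rewrite mulrDl mulrDr cx cy.
by rewrite mulrDl !linearD /= dx dy !mulrDl addrACA.
Qed.

Lemma evenZ k x : even_elt x -> even_elt (k *: x).
Proof.
move=> [cx dx]; split=> [z|a z]; first by rewrite -scalerAl -scalerAr cx.
by rewrite -!scalerAl !linearZ /= dx scalerDr -!scalerAl.
Qed.

Lemma evenM x y : even_elt x -> even_elt y -> even_elt (x * y).
Proof.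
move=> [cx dx] [cy dy]; split=> [z|a z]; first by rewrite -mulrA cy mulrA cx mulrA.
by rewrite -mulrA !dx !dy mulrDr mulrDl !mulrA addrA.
Qed.

Lemma evenX x k : even_elt x -> even_elt (x ^+ k).
Proof.
by move=> ex; elim: k => [|k IH]; [apply: even1 | rewrite exprS; apply: evenM].
Qed.

Lemma even_sum I (r : seq I) (P : pred I) (F : I -> grassmann K m) :
  (forall i, P i -> even_elt (F i)) -> even_elt (\sum_(i <- r | P i) F i).
Proof. by move=> eF; apply: big_ind => //; [apply: even0 | apply: evenD]. Qed.

Lemma gderiv_gvar a b : gderiv a (gvar K b) = ((a == b)%:R)%:A.
Proof. by have := gderiv_gvarM a b (1 : grassmann K m); rewrite gderiv1 mulr0 subr0 mulr1. Qed.

Lemma even_gvar2 a b : even_elt (gvar K a * gvar K b).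
Proof.
split=> [y|c y]; first exact: central_gvarM.
rewrite -mulrA !gderiv_gvarM gderiv_gvar mulrBl mulrBr -!scalerAl -!scalerAr.
by rewrite mulr1 opprD opprK !mulrA addrA !scalerAl.
Qed.

Definition quadratic q : Prop := gdeg (pred1 2%N) q /\ even_elt q.

Lemma quadraticD x y : quadratic x -> quadratic y -> quadratic (x + y).
Proof. by move=> [dx ex] [dy ey]; split; [apply: gdegD | apply: evenD]. Qed.

Lemma quadraticZ k x : quadratic x -> quadratic (k *: x).
Proof. by move=> [dx ex]; split; [apply: gdegZ | apply: evenZ]. Qed.

Lemma quadratic_sum I (r : seq I) (P : pred I) (F : I -> grassmann K m) :
  (forall i, P i -> quadratic (F i)) -> quadratic (\sum_(i <- r | P i) F i).
Proof.
by move=> qF; split; [apply: gdeg_sum => i /qF[] | apply: even_sum => i /qF[]].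
Qed.

Lemma quadratic_gvar2 a b : quadratic (gvar K a * gvar K b).
Proof.
split; last exact: even_gvar2.
by apply: gdegM (@gdeg_gvar K m a) (@gdeg_gvar K m b) => _ _ /eqP-> /eqP->.
Qed.

Section QuadraticExp.

Variable q : grassmann K m.
Hypothesis qq : quadratic q.

Lemma quadraticX_eq0 k : (m < k.*2)%N -> q ^+ k = 0.
Proof.
move=> mk; apply: (@gdeg_eq0 _ _ (pred1 (k * 2)%N)); last exact: gdegX qq.1.
by move=> d dm; rewrite /= neq_ltn muln2 (leq_ltn_trans dm mk).
Qed.

(** High powers of a quadratic element vanish, so the cutoff in [gexp] can be raised. This allows
    exponentials in algebras of different sizes to be compared. *)
Lemma gexp_widen M : (m <= M)%N ->
  \sum_(k < M.+1) (k`!%:R)^-1 *: q ^+ k = gexp q.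
Proof.
move=> mM; rewrite /gexp -!(big_mkord xpredT (fun k => k`!%:R^-1 *: q ^+ k)).
rewrite (big_cat_nat _ (n := m.+1)) //= [X in _ + X]big_nat.
rewrite [X in _ + X]big1 ?addr0 //.
move=> k /andP[mk _]; rewrite quadraticX_eq0 ?scaler0 //.
by apply: leq_trans mk _; rewrite -addnn leq_addr.
Qed.

Lemma even_gexp : even_elt (gexp q).
Proof. by apply: even_sum => k _; apply/evenZ/evenX; case: qq. Qed.

Lemma gexp_set0 : gexp q set0 = 1.
Proof.
rewrite /gexp sum_ffunE big_ord_recl [X in _ + X]big1 => [|k _].
  by rewrite addr0 expr0 fact0 invr1 scale1r goneE eqxx.
rewrite gscaleE; apply/eqP; rewrite mulf_eq0; apply/orP; right.
have /(_ set0) := @gdegX _ _ _ (lift ord0 k) _ qq.1; rewrite cards0 /=.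
by case: eqP => // _ /(_ isT).
Qed.

Lemma gderiv_quadraticX a k : gderiv a (q ^+ k.+1) = k.+1%:R *: (gderiv a q * q ^+ k).
Proof.
elim: k => [|k IH]; first by rewrite expr1 mulr1 scale1r.
rewrite exprS qq.2.2 IH -scalerAr mulrA qq.2.1 -mulrA -exprS.
by rewrite -[k.+2]add1n natrD scalerDl scale1r.
Qed.

Lemma gderiv_gexp a : gderiv a (gexp q) = gderiv a q * gexp q.
Proof.
(* Differentiation lowers the exponent by one, so the left side needs one more term. *)
rewrite -[in LHS](gexp_widen (leqnSn m)) -[in RHS](gexp_widen (leqnn m)).
rewrite linear_sum big_ord_recl linearZ /= expr0 gderiv1 scaler0 add0r.
rewrite mulr_sumr; apply: eq_bigr => k _.
rewrite linearZ /= gderiv_quadraticX scalerA -scalerAr; congr (_ *: _).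
rewrite factS natrM invfM mulrAC mulVf ?mul1r // pnatr_eq0 //.
Qed.

(** The difference of the two sides has no constant term and solves the same first-order system, so
    [gderiv_system_eq0] kills it. *)
Lemma gexp_unique x : (forall a, gderiv a x = gderiv a q * x) ->
  x = x set0 *: gexp q.
Proof.
move=> dx; apply/eqP; rewrite -subr_eq0; apply/eqP.
apply: (@gderiv_system_eq0 _ _ (fun a => gderiv a q)) => [a||a].
- apply: gdeg_gderiv; apply: gdegW qq.1 => d /eqP-> //.
- by rewrite gaddE goppE gscaleE gexp_set0 mulr1 subrr.
- by rewrite linearB linearZ /= dx gderiv_gexp mulrBr -scalerAr.
Qed.

End QuadraticExp.

Lemma gexpD q1 q2 : quadratic q1 -> quadratic q2 ->
  gexp (q1 + q2) = gexp q1 * gexp q2.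
Proof.
move=> h1 h2; have h := quadraticD h1 h2.
have E : (gexp q1 * gexp q2) set0 = 1.
  rewrite gmulE (big_pred1 set0) => [|T]; last by rewrite subset0.
  by rewrite setD0 ginv0l !gexp_set0 // !mulr1.
rewrite [RHS](gexp_unique h) ?E ?scale1r // => a.
rewrite (even_gexp h1).2 !gderiv_gexp // linearD /= mulrDl mulrA.
by congr (_ + _); rewrite !mulrA // (even_gexp h1).1.
Qed.

End Exponential.

Lemma gsubst_gexp (K : numFieldType) m p (v : 'I_m -> grassmann K p) q :
  anticommuting v -> quadratic q -> quadratic (gsubst v q) ->
  gsubst v (gexp q) = gexp (gsubst v q).
Proof.
move=> av qq qvq; rewrite -(gexp_widen qq (leq_addr p m)) -(gexp_widen qvq (leq_addl m p)).
by rewrite linear_sum; apply: eq_bigr => k _; rewrite linearZ /= gsubstX.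
Qed.

(** * Bilinear and quadratic forms in Grassmann variables *)

Section QuadraticForms.

Variable K : numFieldType.

Definition gform m p q (u : 'I_p -> grassmann K m) (N : 'M[K]_(p, q))
    (v : 'I_q -> grassmann K m) : grassmann K m :=
  \sum_a \sum_b N a b *: (u a * v b).

Lemma gquadE m p (v : 'I_p -> grassmann K m) N : gquad v N = gform v N v.
Proof. by []. Qed.

Lemma eq_gform m p q (u u' : 'I_p -> grassmann K m) (N N' : 'M[K]_(p, q)) v v' :
  u =1 u' -> N = N' -> v =1 v' -> gform u N v = gform u' N' v'.
Proof.
move=> uu -> vv; apply: eq_bigr => a _; apply: eq_bigr => b _.
by rewrite uu vv.
Qed.

Lemma gformZ m p q (u : 'I_p -> grassmann K m) k (N : 'M[K]_(p, q)) v :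
  gform u (k *: N) v = k *: gform u N v.
Proof.
rewrite scaler_sumr; apply: eq_bigr => a _; rewrite scaler_sumr.
by apply: eq_bigr => b _; rewrite mxE scalerA.
Qed.

Lemma gform_block m p1 p2 q1 q2 (u : 'I_(p1 + p2) -> grassmann K m)
    (v : 'I_(q1 + q2) -> grassmann K m) (A : 'M[K]_(p1, q1)) B C D :
  gform u (block_mx A B C D) v =
  gform (u \o @lshift p1 p2) A (v \o @lshift q1 q2)
  + gform (u \o @lshift p1 p2) B (v \o @rshift q1 q2)
  + (gform (u \o @rshift p1 p2) C (v \o @lshift q1 q2)
  + gform (u \o @rshift p1 p2) D (v \o @rshift q1 q2)).
Proof.
rewrite /gform big_split_ord /= -!big_split /=; congr (_ + _);
  apply: eq_bigr => a _; rewrite big_split_ord /=; congr (_ + _);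
  apply: eq_bigr => b _.
- by rewrite block_mxEul.
- by rewrite block_mxEur.
- by rewrite block_mxEdl.
- by rewrite block_mxEdr.
Qed.

Lemma gform_mul m p p' q q' (u : 'I_p -> grassmann K m) (v : 'I_q -> grassmann K m)
    (P : 'M[K]_(p', p)) (N : 'M[K]_(p', q')) (Q : 'M[K]_(q', q)) :
  gform (fun i => \sum_a P i a *: u a) N (fun j => \sum_b Q j b *: v b) =
  gform u (P^T *m N *m Q) v.
Proof.
rewrite /gform.
transitivity (\sum_i \sum_j \sum_a \sum_b (P i a * N i j * Q j b) *: (u a * v b)).
  apply: eq_bigr => i _; apply: eq_bigr => j _.
  rewrite mulr_suml scaler_sumr; apply: eq_bigr => a _.
  rewrite mulr_sumr scaler_sumr; apply: eq_bigr => b _.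
  by rewrite -scalerAl -scalerAr !scalerA; congr (_ *: _); ring.
under eq_bigr do rewrite exchange_big /=; rewrite exchange_big /=.
apply: eq_bigr => a _.
under eq_bigr do rewrite exchange_big /=; rewrite exchange_big /=.
apply: eq_bigr => b _.
rewrite mxE scaler_suml exchange_big /=; apply: eq_bigr => j _.
rewrite mxE mulr_suml scaler_suml; apply: eq_bigr => i _.
by rewrite mxE.
Qed.

Lemma gsubst_gform m m' p q (w : 'I_m -> grassmann K m') (u : 'I_p -> grassmann K m)
    (N : 'M[K]_(p, q)) v : anticommuting w ->
  gsubst w (gform u N v) = gform (gsubst w \o u) N (gsubst w \o v).
Proof.
move=> aw; rewrite linear_sum; apply: eq_bigr => a _; rewrite linear_sum.
by apply: eq_bigr => b _; rewrite linearZ /= gsubstM.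
Qed.

Lemma quadratic_gform m p q (h : 'I_p -> 'I_m) (k : 'I_q -> 'I_m) (N : 'M[K]_(p, q)) :
  quadratic (gform (fun a => gvar K (h a)) N (fun b => gvar K (k b))).
Proof.
apply: quadratic_sum => a _; apply: quadratic_sum => b _.
exact/quadraticZ/quadratic_gvar2.
Qed.

(** The row and the column of [a] contribute equally by antisymmetry, whence the factor 2. *)
Lemma gderiv_gquad m (N : 'M[K]_m) a : N^T = - N ->
  gderiv a (gquad (@gvar K m) N) = 2 *: \sum_b N a b *: gvar K b.
Proof.
move=> aN; rewrite linear_sum /=.
under eq_bigr do rewrite linear_sum /=.
under eq_bigr do under eq_bigr do
  rewrite linearZ /= gderiv_gvarM gderiv_gvar -scalerAr mulr1 scalerBr.
under eq_bigr do rewrite sumrB.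
rewrite sumrB [X in _ - X]exchange_big /= (bigD1 a) //=.
rewrite [X in _ + X - _]big1 ?addr0 => [|c ca]; last first.
  by rewrite big1 // => b _; rewrite eq_sym (negPf ca) scale0r scaler0.
rewrite [X in _ - X](bigD1 a) //= [X in _ - (_ + X)]big1 ?addr0 => [|c ca]; last first.
  by rewrite big1 // => b _; rewrite eq_sym (negPf ca) scale0r scaler0.
rewrite scaler_sumr -sumrB; apply: eq_bigr => b _.
have -> : N b a = - N a b by move/matrixP/(_ a b): aN; rewrite !mxE.
by rewrite eqxx !scale1r scaleNr opprK -mulr2n -scaler_nat.
Qed.

End QuadraticForms.

(** * Pfaffians as top coefficients *)

Section GrassmannPfaffian.

Variable K : numClosedFieldType.

(* The Pfaffian as the top coefficient of exp(x^T N x / 2); see Pf_gpf. It      *)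
(* makes sense for every m, and for every N.                                   *)
Definition gpf m (N : 'M[K]_m) : K := gexp (2^-1 *: gquad (@gvar K m) N) setT.

Lemma quadratic_gquad m (N : 'M[K]_m) k : quadratic (k *: gquad (@gvar K m) N).
Proof. exact/quadraticZ/(@quadratic_gform K m m m id id). Qed.

Lemma gsubst_glin_gquad m p (Q : 'M[K]_(m, p)) (N : 'M[K]_m) :
  gsubst (glin Q) (gquad (@gvar K m) N) = gquad (@gvar K p) (Q^T *m N *m Q).
Proof.
have n2 : (2 : K) != 0 by rewrite pnatr_eq0.
rewrite gquadE gsubst_gform; last exact: glin_anticommuting.
rewrite gquadE -gform_mul; apply: eq_gform => // a /=; exact: gsubst_gvar.
Qed.

Lemma gsubst_glin_gexp m p (Q : 'M[K]_(m, p)) (N : 'M[K]_m) k :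
  gsubst (glin Q) (gexp (k *: gquad (@gvar K m) N)) =
  gexp (k *: gquad (@gvar K p) (Q^T *m N *m Q)).
Proof.
have n2 : (2 : K) != 0 by rewrite pnatr_eq0.
rewrite gsubst_gexp ?linearZ /= ?gsubst_glin_gquad //; last 2 first.
- exact: quadratic_gquad.
- exact: quadratic_gquad.
exact: glin_anticommuting.
Qed.

(** The linear substitution by Q turns the form of N into that of Q^T N Q, and its effect on the top
    coefficient is [gsubst_glin_top]. *)
Lemma gpf_congr m (Q N : 'M[K]_m) : gpf (Q^T *m N *m Q) = \det Q * gpf N.
Proof. by rewrite /gpf -gsubst_glin_gexp gsubst_glin_top. Qed.

Lemma gpf_scale m (N : 'M[K]_m) k : gpf (k ^+ 2 *: N) = k ^+ m * gpf N.
Proof.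
have := gpf_congr k%:M N; rewrite det_scalar tr_scalar_mx mul_scalar_mx.
by rewrite mul_mx_scalar scalerA -expr2.
Qed.

Lemma gform0 m p q (u : 'I_p -> grassmann K m) (v : 'I_q -> grassmann K m) :
  gform u 0 v = 0.
Proof. by rewrite /gform big1 // => a _; rewrite big1 // => b _; rewrite mxE scale0r. Qed.

Lemma gsubst_gvar_gexp m p (h : 'I_p -> 'I_m) (N : 'M[K]_p) k :
  gsubst (fun a => gvar K (h a)) (gexp (k *: gquad (@gvar K p) N)) =
  gexp (k *: gquad (fun a => gvar K (h a)) N).
Proof.
have av : anticommuting (fun a => gvar K (h a)).
  by split=> *; [apply: (gvar_anticommuting K m).1 | apply: gvar_anticomm].
have E : gsubst (fun a => gvar K (h a)) (gquad (@gvar K p) N) =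
    gquad (fun a => gvar K (h a)) N.
  by rewrite gquadE gsubst_gform //; apply: eq_gform => // a; apply: gsubst_gvar.
rewrite gsubst_gexp ?linearZ /= ?E //; first exact: quadratic_gquad.
exact/quadraticZ/quadratic_gform.
Qed.

Lemma prod_gvar_setT m : \prod_a gvar K a = [ffun T : {set 'I_m} => (T == setT)%:R].
Proof. by rewrite -prod_gvar; apply: eq_bigl => a; rewrite inE. Qed.

(** By degree only the two full monomials can meet at the top, and no sign appears because the first
    block of generators precedes the second. *)
Lemma gsubst_shift_top m1 m2 (x : grassmann K m1) (y : grassmann K m2) :
  (gsubst (fun a => gvar K (lshift m2 a)) x *
   gsubst (fun a => gvar K (rshift m1 a)) y) setT = x setT * y setT.
Proof.
pose L (S : {set 'I_m1}) := \prod_(a in S) gvar K (@lshift m1 m2 a).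
pose R (S : {set 'I_m2}) := \prod_(a in S) gvar K (@rshift m1 m2 a).
have dLR (S : {set 'I_m1}) (T : {set 'I_m2}) : gdeg (pred1 (#|S| + #|T|)%N) (L S * R T).
  rewrite -!sum1_card; apply: (@gdegM _ _ (pred1 (\sum_(a in S) 1)%N)
    (pred1 (\sum_(a in T) 1)%N)) => [d e /eqP-> /eqP->||]; first exact: eqxx.
  - by apply: gdeg_prod => a _; apply: gdeg_gvar.
  - by apply: gdeg_prod => a _; apply: gdeg_gvar.
have LR0 (S : {set 'I_m1}) (T : {set 'I_m2}) : (S != setT) || (T != setT) -> (L S * R T) setT = 0.
  move=> ST; have := dLR S T setT; case: eqP => // _ /(_ isT) /=.
  rewrite cardsT card_ord => /eqP E.
  have lS := max_card (mem S); have lT := max_card (mem T); move: lS lT E.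
  rewrite !card_ord => lS lT E.
  have eS : #|S| = m1.
    by apply/eqP; rewrite eqn_leq lS -(leq_add2r m2) E leq_add2l.
  have eT : #|T| = m2 by apply/eqP; rewrite -(eqn_add2l m1) -{1}eS E.
  by move: ST; rewrite !eqEcard !subsetT !cardsT !card_ord eS eT !leqnn.
have LR1 : (L setT * R setT) setT = 1.
  have -> : L setT * R setT = \prod_a gvar K a.
    by rewrite big_split_ord; congr (_ * _); apply: eq_bigl => a; rewrite inE.
  by rewrite prod_gvar_setT ffunE eqxx.
rewrite /gsubst mulr_suml sum_ffunE (bigD1 setT) //= [X in _ + X]big1 => [|S ST].
  rewrite addr0 mulr_sumr sum_ffunE (bigD1 setT) //= [X in _ + X]big1 => [|T ST].
    by rewrite addr0 -scalerAl -scalerAr !gscaleE LR1 mulr1.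
  by rewrite -scalerAl -scalerAr !gscaleE LR0 ?ST ?orbT // !mulr0.
rewrite mulr_sumr sum_ffunE big1 // => T _.
by rewrite -scalerAl -scalerAr !gscaleE LR0 ?ST // !mulr0.
Qed.

Lemma gpf_block m1 m2 (N1 : 'M[K]_m1) (N2 : 'M[K]_m2) :
  gpf (block_mx N1 0 0 N2) = gpf N1 * gpf N2.
Proof.
rewrite /gpf -gsubst_shift_top !gsubst_gvar_gexp -gexpD; last 2 first.
- exact/quadraticZ/quadratic_gform.
- exact/quadraticZ/quadratic_gform.
by rewrite -scalerDr !gquadE gform_block !gform0 addr0 add0r.
Qed.

Section PfaffianFormula.

Variable n : nat.

Let ev (k : 'I_n) := Ordinal (even_index_subproof k).
Let od (k : 'I_n) := Ordinal (odd_index_subproof k).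

Lemma half_index_lt (a : 'I_n.*2) : (a./2 < n)%N.
Proof. by rewrite ltn_half_double. Qed.

Lemma prod_pairs (A : nzRingType) (F : 'I_n.*2 -> A) :
  \prod_a F a = \prod_(k < n) (F (ev k) * F (od k)).
Proof.
(* Extending [F] to all natural numbers, by 0 out of range, lets the induction run on [n]. *)
pose G i := if insub i is Some a then F a else 0.
have GE (a : 'I_n.*2) : F a = G a by rewrite /G valK.
under eq_bigr do rewrite GE.
under [RHS]eq_bigr do rewrite !GE /=.
rewrite -(big_mkord xpredT G) -(big_mkord xpredT (fun k => G k.*2 * G k.*2.+1)).
elim: (n) => [|k IH]; first by rewrite !big_nil.
by rewrite doubleS !big_nat_recr //= IH mulrA.
Qed.

(** Only the n-th power in the exponential has degree 2n. It expands over all self-maps of the 2n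
    indices; the noninjective ones vanish and each permutation contributes its sign. *)
Lemma Pf_gpf (N : 'M[K]_n.*2) : Pf N = gpf N.
Proof.
rewrite /gpf /gexp sum_ffunE.
pose q := 2^-1 *: gquad (@gvar K n.*2) N; rewrite -/q.
have dq k : gdeg (pred1 (k * 2)%N) (q ^+ k) by apply: gdegX; case: (quadratic_gquad N 2^-1).
have ln : (n < n.*2.+1)%N by rewrite ltnS -addnn leq_addr.
rewrite (bigD1 (Ordinal ln)) //= [X in _ + X]big1 ?addr0 => [|k kn]; last first.
  rewrite gscaleE; apply/eqP; rewrite mulf_eq0; apply/orP; right.
  apply: contraT => /dq; rewrite /= cardsT card_ord muln2 => /eqP/double_inj E.
  by case/eqP: kn; exact: val_inj.
rewrite gscaleE /q exprZn gscaleE /Pf invfM mulrA exprVn [_^-1 * _]mulrC -!mulrA.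
congr (_ * (_ * _)).
have -> : gquad (@gvar K n.*2) N = \sum_(p : 'I_n.*2 * 'I_n.*2) N p.1 p.2 *: (gvar K p.1 * gvar K p.2).
  by rewrite /gquad pair_bigA.
rewrite -[X in _ ^+ X]card_ord -prodr_const bigA_distr_bigA sum_ffunE /=.
(* A choice of one index pair per factor is the same as a self-map of the 2n positions, position 2k
   and position 2k+1 forming the k-th pair. *)
pose f (g : {ffun 'I_n.*2 -> 'I_n.*2}) : {ffun 'I_n -> 'I_n.*2 * 'I_n.*2} :=
  [ffun k => (g (ev k), g (od k))].
rewrite [RHS](reindex f) /=; last first.
  exists (fun h : {ffun 'I_n -> 'I_n.*2 * 'I_n.*2} =>
    [ffun a => let p := h (Ordinal (half_index_lt a)) in
       if odd a then p.2 else p.1]) => [g|h] _; apply/ffunP => a.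
    set k := Ordinal (half_index_lt a).
    have E : (if odd a then od k else ev k) = a.
      by apply: val_inj; rewrite -[RHS]odd_double_half fun_if /=; case: (odd a).
    by rewrite !ffunE /= -[in RHS]E; case: (odd a).
  rewrite !ffunE /= odd_double /=.
  have E1 : Ordinal (half_index_lt (ev a)) = a by apply: val_inj; rewrite /= doubleK.
  have E2 : Ordinal (half_index_lt (od a)) = a.
    by apply: val_inj; rewrite /= uphalf_double.
  by rewrite E1 E2; case: (h a).
have fE g : \prod_k (N (f g k).1 (f g k).2 *: (gvar K (f g k).1 * gvar K (f g k).2)) =
    (\prod_k N (g (ev k)) (g (od k))) *: \prod_a gvar K (g a).
  rewrite scaler_prod prod_pairs; congr (_ *: _);
  by apply: eq_bigr => k _; rewrite ffunE.
under [RHS]eq_bigr do rewrite fE gscaleE.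
rewrite [RHS](bigID (fun g : {ffun 'I_n.*2 -> 'I_n.*2} => injectiveb g)) /=.
rewrite [X in _ + X]big1 ?addr0 => [|g ng]; last first.
  by rewrite (prod_noninjective (gvar_anticommuting K _) ng) ffunE mulr0.
rewrite [RHS](reindex (@pval _)) /=; last first.
  pose in_Sn := insubd (1%g : 'S_n.*2).
  by exists in_Sn => /= h Uh;
    [apply: val_inj; apply: insubdK; apply: (valP h) | apply: insubdK].
apply: eq_big => [s|s _]; first exact/esym/(valP s).
rewrite mulrC; congr (_ * _); first by apply: eq_bigr => k _; rewrite !pvalE.
have -> : \prod_a gvar K (pval s a) = \prod_a gvar K (s a).
  by apply: eq_bigr => a _; rewrite pvalE.
rewrite (prod_perm s (gvar_anticommuting K _)).
rewrite mulr_sign prod_gvar_setT; case: (s : bool); last by rewrite ffunE eqxx.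
by rewrite goppE ffunE eqxx.
Qed.

End PfaffianFormula.

End GrassmannPfaffian.

(** * Iterated derivatives *)

Section Berezin.

Variables (K : fieldType) (m : nat).
Implicit Types (x y : grassmann K m) (S T : {set 'I_m}) (s : seq 'I_m).

Definition gderivs s x : grassmann K m := foldl (fun y a => gderiv a y) x s.

Lemma berezinE p (v : 'I_p -> 'I_m) x : berezin v x = gderivs (map v (enum 'I_p)) x.
Proof.
rewrite /berezin /gderivs; elim: (enum _) x => //= a s IH x; exact: IH.
Qed.

Lemma gderivs_cat s1 s2 x : gderivs s2 (gderivs s1 x) = gderivs (s1 ++ s2) x.
Proof. by rewrite /gderivs foldl_cat. Qed.

Lemma gderivs_cons a s x : gderivs (a :: s) x = gderivs s (gderiv a x).
Proof. by []. Qed.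

Lemma gderivs_is_linear s : linear (gderivs s).
Proof.
move=> k x y; elim: s x y => //= a s IH x y.
by rewrite linearP IH.
Qed.

HB.instance Definition _ s :=
  GRing.isLinear.Build K (grassmann K m) (grassmann K m) _ (gderivs s)
    (gderivs_is_linear s).

Lemma gderivs_gvarM s b x : b \notin s ->
  gderivs s (gvar K b * x) = (-1) ^+ size s *: (gvar K b * gderivs s x).
Proof.
elim: s x => [|a s IH] x /=; first by rewrite scale1r.
rewrite inE negb_or eq_sym => /andP[/negPf ab bs].
rewrite gderiv_gvarM ab scale0r add0r linearN /= IH //.
by rewrite exprS mulN1r scaleNr.
Qed.

Lemma gderivC a b x : gderiv a (gderiv b x) = - gderiv b (gderiv a x).
Proof.
apply/ffunP => S; rewrite goppE !ffunE !inE.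
have [ab|nab] /= := eqVneq a b.
  by case: ifP; case: ifP; rewrite ?mulr0 oppr0.
case: (boolP (a \in S)) => aS; case: (boolP (b \in S)) => bS;
  rewrite ?mulr0 ?oppr0 //.
have E c d : c \notin S -> d \notin S -> c != d ->
    ginv [set c] (d |: S) = ((d < c)%N + ginv [set c] S)%N.
  by move=> cS dS cd; rewrite ginvUr ?ginv11 // disjoints1.
rewrite !E // 1?eq_sym // setUCA !exprD.
have : (-1) ^+ (b < a)%N * (-1) ^+ (a < b)%N = -1 :> K.
  by case: ltngtP nab => [||/val_inj->]; rewrite ?eqxx ?mulr1 ?mul1r.
case: ltngtP nab => [_|_|/val_inj->]; rewrite ?eqxx // => _ _; rewrite ?expr0 ?expr1; ring.
Qed.

Lemma gderivs_gderiv s b x :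
  gderivs s (gderiv b x) = (-1) ^+ size s *: gderiv b (gderivs s x).
Proof.
elim: s x => [|a s IH] x /=; first by rewrite scale1r.
by rewrite gderivC linearN /= IH exprS mulN1r scaleNr.
Qed.

Lemma gderiv2 b x : gderiv b (gderiv b x) = 0.
Proof.
apply/ffunP => S; rewrite [LHS]ffunE [RHS]ffunE; case: ifP => // _.
by rewrite ffunE setU11 mulr0.
Qed.

(** Integrals of derivatives vanish: up to a sign, the two derivatives in [b] become adjacent. *)
Lemma gderivs_gderiv0 s b x : b \in s -> gderivs s (gderiv b x) = 0.
Proof.
move=> /splitPr[s1 s2]; rewrite -gderivs_cat gderivs_gderiv gderivs_cons linearZ /=.
by rewrite gderiv2 scaler0 linear0.
Qed.

Lemma gderiv_gderivs0 s b x : b \in s -> gderiv b (gderivs s x) = 0.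
Proof.
have n0 : (-1) ^+ size s != 0 :> K by rewrite signr_eq0.
move=> bs; apply: (scalerI n0).
by rewrite -gderivs_gderiv gderivs_gderiv0 ?scaler0.
Qed.

(** Each derivative crosses exactly the generators of S, since the smaller indices of [s] have
    already been removed. *)
Lemma gderivs_coef s S x : sorted (@ord_lt m) s ->
  (forall a b, a \in S -> b \in s -> ord_lt a b) ->
  (gderivs s x) S = (-1) ^+ (#|S| * size s) * x (S :|: [set a in s]).
Proof.
(* Induction peels off the last derivative, whose index then joins the set [S2] of indices above the
   rest of [s]. *)
move=> ss; suff H (S1 S2 : {set 'I_m}) :
    (forall a b, a \in S1 -> b \in s -> ord_lt a b) ->
    (forall a b, a \in S2 -> b \in s -> ord_lt b a) ->
    (gderivs s x) (S1 :|: S2) =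
    (-1) ^+ (#|S1| * size s) * x (S1 :|: S2 :|: [set a in s]).
  by move=> Ss; have := H S set0; rewrite setU0 => -> // a b; rewrite inE.
elim/last_ind: s ss S1 S2 => [|s a IH] ss S1 S2 h1 h2.
  by rewrite muln0 mul1r; congr (x _); apply/setP => b; rewrite !inE orbF.
have ltirr (b : 'I_m) : ord_lt b b = false by rewrite /ord_lt ltnn.
have aS : a \notin S1 :|: S2.
  rewrite inE negb_or; apply/andP; split; apply/negP => aS.
    by have := h1 a a aS; rewrite mem_rcons inE eqxx ltirr => /(_ isT).
  by have := h2 a a aS; rewrite mem_rcons inE eqxx ltirr => /(_ isT).
have sa b : b \in s -> ord_lt b a.
  move: ss; rewrite -cats1; have tr := @ord_lt_trans m.
  rewrite sorted_pairwise // pairwise_cat allrel1r => /andP[/allP + _]; exact.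
rewrite /gderivs -cats1 foldl_cat /= -/(gderivs s x) ffunE (negPf aS).
have -> : ginv [set a] (S1 :|: S2) = #|S1|.
  rewrite /ginv big_set1 big_mkcond -sum1_card [RHS]big_mkcond /=.
  apply: eq_bigr => b _; rewrite inE; case: (boolP (b \in S1)) => bS1 /=.
    by have := h1 b a bS1; rewrite /ord_lt mem_rcons inE eqxx => ->.
  case: ifP => // bS2; have := h2 b a bS2; rewrite /ord_lt mem_rcons inE eqxx.
  by move=> /(_ isT) ab; rewrite ltnNge ltnW.
rewrite setUCA IH.
- rewrite mulrA -exprD cats1 size_rcons mulnS; congr (_ * x _).
  by apply/setP => b; rewrite !inE mem_rcons inE; do 4?case: (_ \in _); case: (_ == _).
- by move: ss; rewrite -cats1 => /cat_sorted2[].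
- by move=> b c bS cs; apply: h1; rewrite // mem_rcons inE cs orbT.
- move=> b c; rewrite !inE => /orP[/eqP-> /sa //|bS cs].
  by apply: h2; rewrite // mem_rcons inE cs orbT.
Qed.

End Berezin.

(** * The square of the Pfaffian *)

Section SymplecticPfaffian.

Variable K : numClosedFieldType.

Definition symplectic_mx m : 'M[K]_(m + m) := block_mx 0 1%:M (- 1%:M) 0.

Lemma symplectic_mx_antisym m : (symplectic_mx m)^T = - symplectic_mx m.
Proof.
by rewrite /symplectic_mx tr_block_mx opp_block_mx !trmx0 linearN /= trmx1 !oppr0 opprK.
Qed.

Lemma gderiv_symplectic m (a : 'I_m) :
  gderiv (rshift m a) (2^-1 *: gquad (@gvar K (m + m)) (symplectic_mx m)) =
  - gvar K (lshift m a).
Proof.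
rewrite linearZ /= gderiv_gquad ?symplectic_mx_antisym // scalerA mulVf ?pnatr_eq0 // scale1r.
rewrite big_split_ord /= [X in _ + X]big1 ?addr0 => [|b _]; last first.
  by rewrite block_mxEdr mxE scale0r.
rewrite (bigD1 a) //= [X in _ + X]big1 ?addr0 => [|b ba]; last first.
  by rewrite block_mxEdl !mxE eq_sym (negPf ba) oppr0 scale0r.
by rewrite block_mxEdl !mxE eqxx scaleN1r.
Qed.

(** Each derivative brings down one generator of the first half. The sign is left unspecified
    because the result is used squared. *)
Lemma gderivs_symplectic m (s : seq 'I_m) : exists e : bool,
  gderivs (map (@rshift m m) s) (gexp (2^-1 *: gquad (@gvar K (m + m)) (symplectic_mx m)))
  = (-1) ^+ e *: ((\prod_(a <- s) gvar K (lshift m a)) *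
      gexp (2^-1 *: gquad (@gvar K (m + m)) (symplectic_mx m))).
Proof.
set W := gexp _; elim/last_ind: s => [|s a [e IH]].
  by exists false; rewrite big_nil mul1r scale1r.
exists (~~ e (+) odd (size s)).
rewrite map_rcons -cats1 -gderivs_cat IH linearZ /= /gderivs /=.
have -> (y : grassmann K (m + m)) : gderiv (rshift m a) ((\prod_(b <- s) gvar K (lshift m b)) * y) =
    (-1) ^+ size s *: ((\prod_(b <- s) gvar K (lshift m b)) * gderiv (rshift m a) y).
  elim: (s) y => [|b t IHt] y; first by rewrite !big_nil !mul1r scale1r.
  rewrite !big_cons -!mulrA gderiv_gvarM eq_rlshift scale0r add0r IHt.
  by rewrite -scalerAr exprS mulN1r scaleNr.
rewrite scalerA gderiv_gexp; last exact: quadratic_gquad.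
rewrite gderiv_symplectic mulNr mulrN scalerN -scaleNr big_rcons /= -mulrA.
by congr (_ *: _); rewrite signr_addb signrN signr_odd mulNr.
Qed.

(** After differentiation in the whole second half, the coefficient at the first half [Z] is, up to
    sign, both the top coefficient and the constant term 1 of the exponential. *)
Lemma gpf_symplectic_sqr m : gpf (symplectic_mx m) ^+ 2 = 1.
Proof.
pose W := gexp (2^-1 *: gquad (@gvar K (m + m)) (symplectic_mx m)).
have [e] := gderivs_symplectic (enum 'I_m); rewrite -/W.
pose Z := [set lshift m a | a : 'I_m].
have sW : sorted (@ord_lt (m + m)) (map (@rshift m m) (enum 'I_m)).
  rewrite sorted_map; have := sorted_index_enum m; rewrite enumT.
  by apply: sub_sorted => a b; rewrite /ord_lt /= ltn_add2l.
have sZ : sorted (@ord_lt (m + m)) (map (@lshift m m) (index_enum 'I_m)).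
  by rewrite sorted_map; apply: sub_sorted (sorted_index_enum m).
move/(congr1 (fun x : grassmann K (m + m) => x Z)).
rewrite gderivs_coef // => [|a b /imsetP[c _ ->] /mapP[d _ ->]]; last first.
  by rewrite /ord_lt /= ltn_addr.
have -> : Z :|: [set a in map (@rshift m m) (enum 'I_m)] = setT.
  apply/setP => a; rewrite !inE; case: (splitP a) => j aj; apply/orP; [left|right].
    by apply/imsetP; exists j => //; apply: val_inj.
  by apply/mapP; exists j; rewrite ?mem_enum //; apply: val_inj.
have -> : \prod_(a <- enum 'I_m) gvar K (lshift m a) = [ffun T : {set 'I_(m + m)} => (T == Z)%:R].
  rewrite enumT -(big_map (@lshift m m) predT (@gvar K (m + m))) prod_gvar_sorted //.
  congr (finfun _); apply: boolp.funext => T; congr (_ == _)%:R.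
  apply/setP => a; rewrite inE; apply/mapP/imsetP => [[b _ ->]|[b _ ->]]; exists b => //.
  by rewrite mem_index_enum.
rewrite gscaleE gmulE (bigD1 Z) //= [X in _ + X]big1 => [|T /andP[_ TZ]]; last first.
  by rewrite ffunE (negPf TZ) mulr0 mul0r.
rewrite setDv ginv0r ffunE eqxx gexp_set0 ?addr0; last exact: quadratic_gquad.
rewrite expr0 mul1r !mulr1 => E; rewrite /gpf -/W.
rewrite -[LHS]mul1r -(sqrr_sign K (#|Z| * size (map (@rshift m m) (enum 'I_m)))) -exprMn E.
by rewrite !sqrr_sign.
Qed.

Lemma det_symplectic m : \det (symplectic_mx m) = 1.
Proof.
have -> : symplectic_mx m =
    block_mx 1%:M 1%:M 0 1%:M *m block_mx 1%:M 0 (- 1%:M) 1%:M *m block_mx 1%:M 1%:M 0 1%:M.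
  rewrite !mulmx_block !(mulmx1, mul1mx, mulmx0, mul0mx, addr0, add0r).
  by rewrite addrN !(mulmx1, mul1mx, mulmx0, mul0mx, addr0, add0r) addNr.
by rewrite !det_mulmx !det_ublock det_lblock !det1 !mulr1.
Qed.

(** The matrix diag(N, N) gives the square on the left. It is congruent, up to the factor 2, to
    [[0, N], [N, 0]], which is itself congruent to the symplectic matrix through diag(N, 1). *)
Lemma gpf_sqr_symplectic m (N : 'M[K]_m) : N^T = - N ->
  gpf N ^+ 2 = (- 'i) ^+ m * gpf (symplectic_mx m) * \det N.
Proof.
move=> aN.
have n2 : (2 : K) != 0 by rewrite pnatr_eq0.
(* With z = x + i y and w = x - i y, x^T N x + y^T N y = z^T N w. *)
pose P : 'M[K]_(m + m) := block_mx 1%:M 1%:M ('i%:M) (- 'i)%:M.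
have detP : \det P = (- 2 * 'i) ^+ m.
  have -> : P = block_mx 1%:M 0 'i%:M 1%:M *m block_mx 1%:M 1%:M 0 (- 2 * 'i)%:M.
    rewrite mulmx_block !(mulmx1, mul1mx, mulmx0, mul0mx, addr0, add0r) /P.
    by congr block_mx; rewrite -raddfD /=; congr (_%:M); ring.
  by rewrite det_mulmx det_lblock det_ublock !det1 det_scalar !mul1r.
pose Q := block_mx N 0 0 1%:M : 'M[K]_(m + m).
have E1 : block_mx 0 N N 0 = Q *m symplectic_mx m *m Q^T.
  rewrite tr_block_mx !trmx0 trmx1 !mulmx_block.
  rewrite !(mulmx1, mul1mx, mulmx0, mul0mx, addr0, add0r, mulNmx, aN, mulmxN, opprK).
  by rewrite oppr0.
(* The factor 2 is written as the square of [sqrtC 2] to fit [gpf_scale]. *)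
have E2 : block_mx ((sqrtC 2) ^+ 2 *: N) 0 0 ((sqrtC 2) ^+ 2 *: N) = P *m block_mx 0 N N 0 *m P^T.
  rewrite sqrtCK tr_block_mx !tr_scalar_mx !mulmx_block.
  rewrite !(mulmx1, mul1mx, mulmx0, mul0mx, addr0, add0r, mul_scalar_mx, mul_mx_scalar).
  rewrite !scalerA mulrN mulNr -!expr2 sqrCi opprK.
  by rewrite !scaleNr addrN addNr scaler_nat mulr2n scale1r.
have := gpf_block ((sqrtC 2) ^+ 2 *: N) ((sqrtC 2) ^+ 2 *: N).
rewrite E2 -{1}[P]trmxK gpf_congr det_tr detP E1 -{1}[Q]trmxK gpf_congr det_tr.
rewrite det_ublock det1 mulr1 !gpf_scale => E.
have s2 : sqrtC 2 ^+ m * sqrtC 2 ^+ m = 2 ^+ m :> K by rewrite -exprMn -expr2 sqrtCK.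
apply: (mulfI (expf_neq0 m n2)); rewrite -[in LHS]s2 expr2 mulrACA -E.
have -> : - 2 * 'i = 2 * - 'i :> K by ring.
by rewrite exprMn -!mulrA [\det N * _]mulrC.
Qed.

(* The constant in gpf_sqr_symplectic is found by applying that formula to the *)
(* symplectic matrix itself.                                                   *)
Lemma gpf_sqr m (N : 'M[K]_(m + m)) : N^T = - N -> gpf N ^+ 2 = \det N.
Proof.
move=> aN; rewrite gpf_sqr_symplectic //.
have := gpf_sqr_symplectic (symplectic_mx_antisym m).
by rewrite det_symplectic gpf_symplectic_sqr mulr1 => <-; rewrite mul1r.
Qed.

(** * The Pfaffian of the transfer matrix *)

Section TransferMatrix.

Variables (m : nat) (M D : 'M[K]_m).
Hypotheses (aM : M^T = - M) (aD : D^T = - D).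

(** The matrix of the integrand in (eta, mu) once theta is set to 0; see [full_action_eta_mu]. *)
Definition transfer_mx : 'M[K]_(m + m) := block_mx D 1%:M (- 1%:M) M.

Lemma transfer_mx_antisym : transfer_mx^T = - transfer_mx.
Proof.
by rewrite /transfer_mx tr_block_mx opp_block_mx linearN /= trmx1 opprK aM aD.
Qed.

Lemma det_transfer_mx : \det transfer_mx = \det (1%:M + M *m D).
Proof.
have -> : transfer_mx = block_mx 1%:M 0 M (1%:M + M *m D) *m symplectic_mx m
    *m block_mx 1%:M 0 D 1%:M.
  rewrite !mulmx_block !(mulmx1, mul1mx, mulmx0, mul0mx, addr0, add0r, mulmxN).
  by rewrite opprD addrAC -addrA subrr addr0.
by rewrite !det_mulmx !det_lblock !det1 det_symplectic !mulr1 mul1r.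
Qed.

Lemma gpf_transfer_sqr : gpf transfer_mx ^+ 2 = \det (1%:M + M *m D).
Proof. by rewrite gpf_sqr ?det_transfer_mx ?transfer_mx_antisym. Qed.

Lemma gpf_transfer : M \in unitmx -> gpf transfer_mx = gpf M * gpf (invmx M + D).
Proof.
move=> uM; pose P : 'M[K]_(m + m) := block_mx 1%:M (invmx M) 0 1%:M.
have aV : (invmx M)^T = - invmx M.
  have uN : - M \in unitmx by rewrite -scaleN1r unitmxZ ?unitrN1.
  rewrite trmx_inv aM; apply: (can_inj (mulKmx uN)).
  by rewrite mulmxV // mulNmx mulmxN opprK mulmxV.
have -> : transfer_mx = P *m block_mx (invmx M + D) 0 0 M *m P^T.
  rewrite tr_block_mx !trmx1 trmx0 aV !mulmx_block.
  rewrite !(mulmx1, mul1mx, mulmx0, mul0mx, addr0, add0r, mulmxN, mulVmx) //.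
  by rewrite mulmxV // addrAC subrr add0r.
rewrite -{1}[P]trmxK gpf_congr det_tr det_ublock !det1 !mul1r gpf_block.
exact: mulrC.
Qed.

End TransferMatrix.

End SymplecticPfaffian.

(** * Gaussian integrals *)

Section GaussianIntegral.

Variables (K : numClosedFieldType) (n : nat).
Implicit Types (A B D M N : 'M[K]_n.*2).

Local Notation m := n.*2.

Lemma gform_col_mx r p1 p2 q (u : 'I_(p1 + p2) -> grassmann K r)
    (v : 'I_q -> grassmann K r) (N1 : 'M[K]_(p1, q)) (N2 : 'M[K]_(p2, q)) :
  gform u (col_mx N1 N2) v =
  gform (u \o @lshift p1 p2) N1 v + gform (u \o @rshift p1 p2) N2 v.
Proof.
by rewrite /gform big_split_ord /=; congr (_ + _); apply: eq_bigr => a _;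
  apply: eq_bigr => b _; rewrite ?col_mxEu ?col_mxEd.
Qed.

Lemma gform_row_mx r p q1 q2 (u : 'I_p -> grassmann K r)
    (v : 'I_(q1 + q2) -> grassmann K r) (N1 : 'M[K]_(p, q1)) (N2 : 'M[K]_(p, q2)) :
  gform u (row_mx N1 N2) v =
  gform u N1 (v \o @lshift q1 q2) + gform u N2 (v \o @rshift q1 q2).
Proof.
rewrite /gform -big_split; apply: eq_bigr => a _; rewrite big_split_ord /=.
by congr (_ + _); apply: eq_bigr => b _; rewrite ?row_mxEl ?row_mxEr.
Qed.

Lemma gform1 r p (u v : 'I_p -> grassmann K r) : gform u 1%:M v = gdot u v.
Proof.
apply: eq_bigr => a _; rewrite (bigD1 a) //= mxE eqxx scale1r big1 ?addr0 // => b.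
by rewrite eq_sym => /negPf ba; rewrite mxE ba scale0r.
Qed.

Lemma gformN r p q (u : 'I_p -> grassmann K r) (N : 'M[K]_(p, q)) v :
  gform u (- N) v = - gform u N v.
Proof. by rewrite -scaleN1r gformZ scaleN1r. Qed.

Lemma gdot_gvarC r p (h k : 'I_p -> 'I_r) :
  gdot (fun a => gvar K (h a)) (fun a => gvar K (k a)) =
  - gdot (fun a => gvar K (k a)) (fun a => gvar K (h a)).
Proof. by rewrite /gdot -sumrN; apply: eq_bigr => a _; rewrite gvar_anticomm. Qed.

(** The matrix of the whole exponent in the order theta, eta, mu. The coupling of eta and mu is
    split evenly between the blocks 1 and -1. *)
Definition full_action_mx A B D M : 'M[K]_(m + m + m) :=
  block_mx (block_mx A B (- B^T) D) (col_mx 0 1%:M) (row_mx 0 (- 1%:M)) M.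

Definition integrand A B D M : grassmann K (m + m + m) :=
  gexp (gaussian_action A B D +
        'i *: gdot (fun a : 'I_m => gvar K (eta a)) (fun a : 'I_m => gvar K (mu a))) *
  gsubst (fun a : 'I_m => gvar K (mu a)) (gexp ('i / 2 *: gquad (@gvar K m) M)).

Lemma integrandE A B D M :
  integrand A B D M = gexp ('i / 2 *: gquad (@gvar K _) (full_action_mx A B D M)).
Proof.
rewrite /integrand gsubst_gvar_gexp -gexpD; last 2 first.
- apply: quadraticD; first exact/quadraticZ/quadratic_gform.
  by apply: quadraticZ; rewrite -gform1; apply: quadratic_gform.
- exact/quadraticZ/quadratic_gform.
congr gexp; rewrite /gaussian_action !gquadE (gform_block (@gvar K _)).
rewrite [gform _ (col_mx 0 _) _]gform_col_mx [gform _ (row_mx 0 _) _]gform_row_mx.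
rewrite !gform0 !add0r gformN !gform1.
rewrite (gdot_gvarC (fun a => rshift (m + m) a) (fun a => lshift m (rshift m a))) opprK.
rewrite addrA !scalerDr -!addrA; congr (_ + _); rewrite addrA -scalerDl; congr (_ *: _ + _).
exact: splitr.
Qed.

Lemma full_action_mx_antisym A B D M : A^T = - A -> D^T = - D -> M^T = - M ->
  (full_action_mx A B D M)^T = - full_action_mx A B D M.
Proof.
move=> aA aD aM; rewrite /full_action_mx !tr_block_mx tr_col_mx tr_row_mx !opp_block_mx.
rewrite opp_col_mx opp_row_mx aA aD aM !linearN /= !trmxK !trmx1 !trmx0 !oppr0 !opprK.
by [].
Qed.

Definition int_word : seq 'I_(m + m + m) :=
  map (@mu n) (enum 'I_m) ++ map (@eta n) (enum 'I_m).

Lemma berezin_int_word x :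
  berezin (@eta n) (berezin (@mu n) x) = gderivs int_word x :> grassmann K _.
Proof. by rewrite !berezinE gderivs_cat. Qed.

(** Evenness lets theta variables and theta derivatives cross the integral without a sign. *)
Lemma odd_size_int_word : odd (size int_word) = false.
Proof. by rewrite size_cat !size_map addnn odd_double. Qed.

Lemma mu_in_word a : mu a \in int_word.
Proof. by rewrite mem_cat map_f ?mem_enum. Qed.

Lemma eta_in_word a : eta a \in int_word.
Proof. by rewrite mem_cat orbC map_f ?mem_enum. Qed.

Lemma theta_notin_word (a : 'I_m) : theta a \notin int_word.
Proof.
rewrite mem_cat negb_or; apply/andP; split; apply/mapP => -[b _].
  by move/eqP; rewrite eq_lrshift.
by move/lshift_inj/eqP; rewrite eq_lrshift.
Qed.

Lemma sum_theta_eta_mu (V : nmodType) (f : 'I_(m + m + m) -> V) :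
  \sum_z f z = \sum_(a < m) f (theta a) + \sum_(a < m) f (eta a) + \sum_(a < m) f (mu a).
Proof. by rewrite big_split_ord big_split_ord. Qed.

Section Antisymmetric.

Variables A B D M : 'M[K]_n.*2.
Hypotheses (aA : A^T = - A) (aD : D^T = - D) (aM : M^T = - M).

Let W := integrand A B D M.
Let F := gderivs int_word W.

Lemma gderiv_integrand z :
  gderiv z W = \sum_y ('i * full_action_mx A B D M z y) *: (gvar K y * W).
Proof.
rewrite /W integrandE gderiv_gexp; last exact: quadratic_gquad.
rewrite linearZ /= gderiv_gquad; last exact: full_action_mx_antisym.
rewrite scalerA divfK ?pnatr_eq0 // scaler_sumr mulr_suml; apply: eq_bigr => y _.
by rewrite scalerA -scalerAl.
Qed.

Lemma gderivs_gvar_theta (a : 'I_m) :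
  gderivs int_word (gvar K (theta a) * W) = gvar K (theta a) * F.
Proof.
rewrite gderivs_gvarM ?theta_notin_word // -signr_odd odd_size_int_word.
by rewrite scale1r.
Qed.

Lemma schwinger_dyson z : gderivs int_word (gderiv z W) =
  \sum_y ('i * full_action_mx A B D M z y) *: gderivs int_word (gvar K y * W).
Proof. by rewrite gderiv_integrand linear_sum; apply: eq_bigr => y _; rewrite linearZ. Qed.

(** The moments of theta, eta and mu are read at a fixed monomial S, so that relations between
    Grassmann elements become matrix identities over [K]. *)
Let fth S : 'cV[K]_m := \col_a (gvar K (theta a) * F) S.
Let fet S : 'cV[K]_m := \col_a (gderivs int_word (gvar K (eta a) * W)) S.
Let fmu S : 'cV[K]_m := \col_a (gderivs int_word (gvar K (mu a) * W)) S.

Let fthE S a : fth S a 0 = (gvar K (theta a) * F) S. Proof. by rewrite mxE. Qed.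
Let fetE S a : fet S a 0 = (gderivs int_word (gvar K (eta a) * W)) S.
Proof. by rewrite mxE. Qed.
Let fmuE S a : fmu S a 0 = (gderivs int_word (gvar K (mu a) * W)) S.
Proof. by rewrite mxE. Qed.

Lemma schwinger_dyson_coef z S : (gderivs int_word (gderiv z W)) S =
  'i * (\sum_a full_action_mx A B D M z (theta a) * fth S a 0 +
        \sum_a full_action_mx A B D M z (eta a) * fet S a 0 +
        \sum_a full_action_mx A B D M z (mu a) * fmu S a 0).
Proof.
rewrite schwinger_dyson sum_ffunE sum_theta_eta_mu !mulrDr !mulr_sumr.
by congr (_ + _ + _); apply: eq_bigr => a _;
  rewrite gscaleE -mulrA ?gderivs_gvar_theta ?(fthE, fetE, fmuE).
Qed.

(* The integral of the derivative of the integrand in mu a vanishes.           *)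
Lemma schwinger_dyson_mu S : fet S = M *m fmu S.
Proof.
apply/matrixP => a j; rewrite (ord1 j) {j}.
have := schwinger_dyson_coef (mu a) S.
rewrite gderivs_gderiv0 ?mu_in_word // [X in X = _ -> _]ffunE => /esym/eqP.
rewrite mulf_eq0 (negPf (neq0Ci _)) /= => /eqP; rewrite [X in X + _ + _]big1 => [|b _]; last first.
  by rewrite /full_action_mx block_mxEdl row_mxEl mxE mul0r.
rewrite add0r (bigD1 a) //= [X in _ + X + _]big1 => [|b ba]; last first.
  by rewrite /full_action_mx block_mxEdl row_mxEr !mxE eq_sym (negPf ba) oppr0 mul0r.
have N1 : (- 1%:M : 'M[K]_m) a a = - 1 by rewrite !mxE eqxx.
rewrite {1}/full_action_mx block_mxEdl row_mxEr N1 addr0 mulN1r addrC.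
move/eqP; rewrite subr_eq0 => /eqP <-; rewrite [RHS]mxE; apply: eq_bigr => b _.
by rewrite block_mxEdr.
Qed.

(** The integral of the derivative of the integrand in [eta a] vanishes too. *)
Lemma schwinger_dyson_eta S : fmu S = B^T *m fth S - D *m fet S.
Proof.
apply/matrixP => a j; rewrite (ord1 j) {j}.
have := schwinger_dyson_coef (eta a) S.
rewrite gderivs_gderiv0 ?eta_in_word // [X in X = _ -> _]ffunE => /esym/eqP.
rewrite mulf_eq0 (negPf (neq0Ci _)) /= => /eqP E.
have E1 : \sum_b full_action_mx A B D M (eta a) (theta b) * fth S b 0 = - (B^T *m fth S) a 0.
  rewrite mxE -sumrN; apply: eq_bigr => b _.
  by rewrite /full_action_mx block_mxEul block_mxEdl mxE mulNr.
have E2 : \sum_b full_action_mx A B D M (eta a) (eta b) * fet S b 0 = (D *m fet S) a 0.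
  rewrite mxE; apply: eq_bigr => b _.
  by rewrite /full_action_mx block_mxEul block_mxEdr.
have E3 : \sum_b full_action_mx A B D M (eta a) (mu b) * fmu S b 0 = fmu S a 0.
  rewrite (bigD1 a) //= big1 => [|b ba].
    by rewrite /full_action_mx block_mxEur col_mxEd mxE eqxx mul1r addr0.
  by rewrite /full_action_mx block_mxEur col_mxEd mxE eq_sym (negPf ba) mul0r.
move: E; rewrite E1 E2 E3 => /eqP; rewrite addr_eq0 => /eqP E.
by rewrite -[LHS]opprK -E opprD opprK [RHS]mxE [X in _ = _ + X]mxE.
Qed.

Let EM := B *m invmx (1%:M + M *m D) *m M *m B^T + A.

Lemma gderiv_integral_theta (a : 'I_m) : 1%:M + M *m D \in unitmx ->
  gderiv (theta a) F = 'i *: \sum_b EM a b *: (gvar K (theta b) * F).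
Proof.
move=> uMD; apply/ffunP => S.
have fetE' : fet S = invmx (1%:M + M *m D) *m M *m B^T *m fth S.
  (* The moments of mu are eliminated between the two relations. *)
  have E : (1%:M + M *m D) *m fet S = M *m B^T *m fth S.
    rewrite mulmxDl mul1mx {1}schwinger_dyson_mu {1}schwinger_dyson_eta mulmxBr.
    by rewrite !mulmxA subrK.
  by rewrite -[LHS](mulKmx uMD) E !mulmxA.
have -> : gderiv (theta a) F = gderivs int_word (gderiv (theta a) W).
  by rewrite gderivs_gderiv -signr_odd odd_size_int_word scale1r.
rewrite schwinger_dyson_coef gscaleE sum_ffunE; congr (_ * _).
rewrite [X in _ + X]big1 => [|b _]; last first.
  by rewrite /full_action_mx block_mxEur col_mxEu mxE mul0r.
have -> : \sum_b (EM a b *: (gvar K (theta b) * F)) S = (EM *m fth S) a 0.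
  by rewrite mxE; apply: eq_bigr => b _; rewrite gscaleE fthE.
have -> : (EM *m fth S) a 0 = (A *m fth S) a 0 + (B *m fet S) a 0.
  by rewrite /EM mulmxDl addrC mxE fetE' !mulmxA.
rewrite addr0; congr (_ + _); rewrite [RHS]mxE; apply: eq_bigr => b _.
  by rewrite /full_action_mx !block_mxEul.
by rewrite /full_action_mx block_mxEul block_mxEur.
Qed.

(** Transposition exchanges MD with DM, and (1 + MD)^-1 M = M (1 + DM)^-1 brings the product
    back. *)
Lemma output_correlation_antisym : 1%:M + M *m D \in unitmx -> EM^T = - EM.
Proof.
have tMD : (1%:M + M *m D)^T = 1%:M + D *m M.
  by rewrite linearD /= trmx1 trmx_mul aM aD mulNmx mulmxN opprK.
move=> uMD; have uMD' : 1%:M + D *m M \in unitmx by rewrite -tMD unitmx_tr.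
have E : invmx (1%:M + M *m D) *m M = M *m invmx (1%:M + D *m M).
  apply: (can_inj (mulKmx uMD)); rewrite mulmxA mulmxV // mul1mx mulmxA.
  have -> : (1%:M + M *m D) *m M = M *m (1%:M + D *m M).
    by rewrite mulmxDl mulmxDr mulmx1 mul1mx mulmxA.
  by rewrite mulmxK.
rewrite /EM linearD /= aA opprD; congr (_ + _).
rewrite !trmx_mul trmxK trmx_inv tMD aM -[in RHS](mulmxA B) E.
by rewrite mulNmx mulmxN !mulmxA.
Qed.

Lemma gaussian_integral_form : 1%:M + M *m D \in unitmx ->
  F = F set0 *: gsubst (fun a : 'I_m => gvar K (theta a))
        (gexp ('i / 2 *: gquad (@gvar K m) EM)).
Proof.
move=> uMD; rewrite gsubst_gvar_gexp.
(* The integral no longer involves eta and mu, so [EM] is padded with zeros to a matrix on all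
   generators and [gexp_unique] applies. *)
pose N : 'M[K]_(m + m + m) := block_mx (block_mx EM 0 0 0) 0 0 0.
have aN : N^T = - N.
  by rewrite /N !tr_block_mx !opp_block_mx !trmx0 !oppr0 output_correlation_antisym.
have <- : gquad (@gvar K _) N = gquad (fun a : 'I_m => gvar K (theta a)) EM.
  rewrite !gquadE /N (gform_block (@gvar K _)) (gform_block (@gvar K _ \o _)).
  by rewrite !gform0 !addr0.
apply: gexp_unique; first exact: quadratic_gquad.
move=> z; rewrite linearZ /= gderiv_gquad // scalerA divfK ?pnatr_eq0 //.
rewrite -scalerAl mulr_suml.
under eq_bigr do rewrite -scalerAl.
have z0 z' : (forall y, N z' y = 0) -> z' \in int_word ->
    gderiv z' F = 'i *: \sum_y N z' y *: (gvar K y * F).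
  move=> Nz zi; rewrite gderiv_gderivs0 // big1 ?scaler0 // => y _.
  by rewrite Nz scale0r.
have [t ->|a ->] := split_ordP z; last first.
  apply: z0 => [y|]; last exact: mu_in_word.
  by rewrite /N block_mxEv col_mxEd row_mx0 mxE.
have [a ->|a ->] := split_ordP t; last first.
  apply: z0 => [y|]; last exact: eta_in_word.
  rewrite /N block_mxEv col_mxEu; have [y' ->|y' ->] := split_ordP y.
    by rewrite row_mxEl block_mxEv col_mxEd row_mx0 mxE.
  by rewrite row_mxEr mxE.
rewrite -/(theta a) gderiv_integral_theta // sum_theta_eta_mu; congr (_ *: _).
rewrite [X in _ + X + _]big1 => [|b _]; last first.
  by rewrite /N block_mxEul block_mxEur mxE scale0r.
rewrite [X in _ + _ + X]big1 => [|b _]; last by rewrite /N block_mxEur mxE scale0r.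
by rewrite !addr0; apply: eq_bigr => b _; rewrite /N !block_mxEul.
Qed.

End Antisymmetric.

(** * The constant term of the Gaussian integral *)

Lemma sorted_shift r p (h : 'I_p -> 'I_r) : {homo h : a b / (a < b)%N >-> (a < b)%N} ->
  sorted (@ord_lt r) (map h (enum 'I_p)).
Proof.
move=> hh; have -> : enum 'I_p = index_enum 'I_p by rewrite enumT.
rewrite sorted_map; apply: sub_sorted (sorted_index_enum p) => a b; exact: hh.
Qed.

Definition eta_mu_set : {set 'I_(m + m + m)} :=
  [set a in map (@eta n) (enum 'I_m)] :|: [set a in map (@mu n) (enum 'I_m)].

(** Each of the 2n derivatives in mu crosses 2n generators eta, so the total sign is 1. *)
Lemma gderivs_set0 (x : grassmann K (m + m + m)) :
  (gderivs int_word x) set0 = x eta_mu_set.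
Proof.
rewrite -gderivs_cat gderivs_coef => [||a b]; last by rewrite inE.
  rewrite cards0 mul1r set0U gderivs_coef.
  - by rewrite size_map size_enum_ord mulnC -signr_odd oddM odd_double mul1r.
  - by apply: sorted_shift => a b ab; rewrite /= ltn_add2l.
  - move=> a b; rewrite inE => /mapP[c _ ->] /mapP[d _ ->].
    by rewrite /ord_lt /= ltn_addr // ltn_add2l.
by apply: sorted_shift => a b ab; rewrite /= ltn_add2l.
Qed.

(* The substitution that sets theta to 0 and maps (eta, mu) to the generators  *)
(* of the algebra on 4n variables.                                             *)
Definition eta_mu_mx : 'M[K]_(m + m + m, m + m) := block_mx (col_mx 0 1%:M) 0 0 1%:M.

Lemma glin_eta_mu_theta (a : 'I_m) : glin eta_mu_mx (theta a) = 0.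
Proof.
rewrite /glin big1 // => b _; have [b' ->|b' ->] := split_ordP b.
  by rewrite /eta_mu_mx block_mxEul col_mxEu mxE scale0r.
by rewrite /eta_mu_mx block_mxEur mxE scale0r.
Qed.

Lemma glin_eta_mu_eta (a : 'I_m) : glin eta_mu_mx (eta a) = gvar K (lshift m a).
Proof.
rewrite /glin big_split_ord /= [X in _ + X]big1 ?addr0 => [|b _]; last first.
  by rewrite /eta_mu_mx block_mxEur mxE scale0r.
rewrite (bigD1 a) //= [X in _ + X]big1 ?addr0 => [|b ba]; last first.
  by rewrite /eta_mu_mx block_mxEul col_mxEd mxE eq_sym (negPf ba) scale0r.
by rewrite /eta_mu_mx block_mxEul col_mxEd mxE eqxx scale1r.
Qed.

Lemma glin_eta_mu_mu (a : 'I_m) : glin eta_mu_mx (mu a) = gvar K (rshift m a).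
Proof.
rewrite /glin big_split_ord /= [X in X + _]big1 ?add0r => [|b _]; last first.
  by rewrite /eta_mu_mx block_mxEdl mxE scale0r.
rewrite (bigD1 a) //= [X in _ + X]big1 ?addr0 => [|b ba]; last first.
  by rewrite /eta_mu_mx block_mxEdr mxE eq_sym (negPf ba) scale0r.
by rewrite /eta_mu_mx block_mxEdr mxE eqxx scale1r.
Qed.

(** Monomials containing some theta are sent to 0, and those missing some eta or mu have too small a
    degree. *)
Lemma gsubst_eta_mu_top (x : grassmann K (m + m + m)) :
  (gsubst (glin eta_mu_mx) x) setT = x eta_mu_set.
Proof.
have inU (z : 'I_(m + m + m)) : (z \in eta_mu_set) = (z \notin map (@theta n) (enum 'I_m)).
  rewrite !inE; have [t ->|a ->] := split_ordP z; last first.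
    rewrite (map_f (@mu n)) ?mem_enum // orbT; apply/esym/mapP => -[b _ /eqP].
    by rewrite eq_rlshift.
  have [a ->|a ->] := split_ordP t; last first.
    rewrite (map_f (@eta n)) ?mem_enum //=; apply/esym/mapP => -[b _ /lshift_inj/eqP].
    by rewrite eq_rlshift.
  rewrite (map_f (@theta n)) ?mem_enum //=; apply/negbTE; rewrite negb_or.
  apply/andP; split; apply/mapP => -[b _].
    by move/lshift_inj/eqP; rewrite eq_lrshift.
  by move/eqP; rewrite eq_lrshift.
rewrite /gsubst sum_ffunE (bigD1 eta_mu_set) //= [X in _ + X]big1 => [|S SU].
  rewrite addr0 gscaleE -[RHS]mulr1; congr (_ * _).
  have -> : \prod_(a in eta_mu_set) glin eta_mu_mx a = \prod_a gvar K a.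
    rewrite big_split_ord [RHS]big_split_ord; congr (_ * _); last first.
      apply: eq_big => [a|a _]; last exact: glin_eta_mu_mu.
      by rewrite !inE (map_f (@mu n)) ?mem_enum // orbT.
    rewrite big_split_ord /= [X in X * _]big1 => [|a]; last first.
      by rewrite inU (map_f (@theta n)) ?mem_enum.
    rewrite mul1r; apply: eq_big => [a|a _]; last exact: glin_eta_mu_eta.
    by rewrite !inE (map_f (@eta n)) ?mem_enum.
  by rewrite prod_gvar_setT ffunE eqxx.
rewrite gscaleE; apply/eqP; rewrite mulf_eq0; apply/orP; right.
have [sSU|/subsetPn[z zS]] := boolP (S \subset eta_mu_set); last first.
  rewrite inU negbK => /mapP[a _ za]; have : z \in set_word S.
    by rewrite mem_filter zS mem_index_enum.
  rewrite prod_set_word => /splitPr[s1 s2].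
  by rewrite big_cat big_cons /= za glin_eta_mu_theta mul0r mulr0 ffunE.
have := @gdeg_prod K (m + m) _ (index_enum _) [in S] (glin eta_mu_mx)
  (fun a _ => @gdeg_glin _ _ _ eta_mu_mx a).
move/(_ setT); case: eqP => // _ /(_ isT) /=; rewrite sum1_card cardsT card_ord => /eqP cS.
case/negP: SU; rewrite eqEcard sSU -cS.
rewrite (leq_trans (leq_card_setU _ _)) // leq_add //;
by rewrite cardsE (leq_trans (card_size _)) // size_map size_enum_ord.
Qed.

Lemma full_action_eta_mu A B D M :
  eta_mu_mx^T *m full_action_mx A B D M *m eta_mu_mx = transfer_mx M D.
Proof.
rewrite /eta_mu_mx /full_action_mx tr_block_mx tr_col_mx !trmx1 !trmx0 !mulmx_block.
rewrite !(mul0mx, mulmx0, mul1mx, mulmx1, addr0, add0r).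
rewrite mul_row_block !(mul0mx, mul1mx, add0r) !mul_row_col.
by rewrite !(mulmx0, mulmx1, add0r, addr0).
Qed.

(** Having i/2 instead of 1/2 in the exponent rescales the matrix by i, which by [gpf_scale]
    contributes the 4n-th power of a square root of i, that is (-1)^n. *)
Lemma gaussian_integral_const A B D M :
  gderivs int_word (integrand A B D M) set0 = (-1) ^+ n * gpf (transfer_mx M D).
Proof.
rewrite gderivs_set0 -gsubst_eta_mu_top integrandE gsubst_glin_gexp full_action_eta_mu.
have -> : 'i / 2 *: gquad (gvar K (m:=m + m)) (transfer_mx M D) =
    2^-1 *: gquad (gvar K (m:=m + m)) (sqrtC 'i ^+ 2 *: transfer_mx M D).
  by rewrite !gquadE gformZ sqrtCK scalerA mulrC.
have -> : (-1) ^+ n = sqrtC 'i ^+ (m + m) :> K.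
  by rewrite addnn -mul2n exprM sqrtCK -mul2n exprM sqrCi.
by rewrite -gpf_scale.
Qed.

End GaussianIntegral.

(** * Gaussian maps *)

Section GaussianMaps.

Variables (K : numClosedFieldType) (n : nat).
Local Notation m := n.*2.
Variable c : 'I_m -> 'M[K]_(2 ^ n).
Hypothesis cC : clifford_generators c.
Implicit Types (X : 'M[K]_(2 ^ n)).

Lemma trace_grassmann_rep X : \tr X = 2 ^+ n * grassmann_rep c X set0.
Proof.
rewrite -{1}(quantizeK cC X); move: (grassmann_rep c X) => x.
rewrite /quantize raddf_sum (bigD1 set0) //= mxtraceZ.
have m0 : monomial c set0 = 1%:M by rewrite /monomial big_set0.
rewrite m0 mxtrace1 natrX mulrC big1 ?addr0 // => S S0.
by have := monomial_trace cC S0; rewrite m0 invmx1 mul1mx mxtraceZ => ->; rewrite mulr0.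
Qed.

Lemma gsubst_set0 m1 m2 (h : 'I_m1 -> 'I_m2) (x : grassmann K m1) :
  (gsubst (fun a => gvar K (h a)) x) set0 = x set0.
Proof.
rewrite /gsubst sum_ffunE (bigD1 set0) //= [X in _ + X]big1 => [|S S0].
  by rewrite big_set0 gscaleE goneE eqxx mulr1 addr0.
rewrite gscaleE; apply/eqP; rewrite mulf_eq0; apply/orP; right.
have := @gdeg_prod K m2 _ (index_enum _) [in S] _ (fun a _ => @gdeg_gvar K m2 (h a)).
move/(_ set0); case: eqP => // _ /(_ isT) /=; rewrite sum1_card cards0 eq_sym cards_eq0.
by rewrite (negPf S0).
Qed.

(** The substitution that maps theta back and sets eta and mu to 0 is a left inverse. *)
Lemma gsubst_theta_inj :
  injective (gsubst (fun a : 'I_m => gvar K (theta a))).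
Proof.
pose Q : 'M[K]_(m + m + m, m) := col_mx (col_mx 1%:M 0) 0.
apply: (can_inj (g := gsubst (glin Q))) => x.
rewrite gsubst_comp; last by apply: glin_anticommuting; rewrite pnatr_eq0.
rewrite -[RHS]gsubst_id; apply: eq_gsubst => a; rewrite gsubst_gvar /glin.
rewrite (bigD1 a) //= [X in _ + X]big1 ?addr0 => [|b ba]; last first.
  by rewrite !col_mxEu mxE eq_sym (negPf ba) scale0r.
by rewrite !col_mxEu mxE eqxx scale1r.
Qed.

Lemma gaussian_form_const X CX M : gaussian_form c X CX M ->
  grassmann_rep c X set0 = CX.
Proof.
by case=> _ ->; rewrite gscaleE gexp_set0 ?mulr1 //; apply: quadratic_gquad.
Qed.

Lemma gaussian_form_trace X CX M : gaussian_form c X CX M -> \tr X = 2 ^+ n * CX.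
Proof. by move=> gX; rewrite trace_grassmann_rep (gaussian_form_const gX). Qed.

Lemma gaussian_form_quantize CX M : antisymmetric_mx M ->
  gaussian_form c (quantize c (CX *: gexp ('i / 2 *: gquad (@gvar K m) M))) CX M.
Proof. by move=> aM; split => //; rewrite grassmann_repK. Qed.

Section GaussianMap.

Variables (E : {linear 'M[K]_(2 ^ n) -> 'M[K]_(2 ^ n)}) (A B D : 'M[K]_m) (C : K).
Hypotheses (aA : antisymmetric_mx A) (aD : antisymmetric_mx D).
Hypothesis EG : gaussian_integral_rep c E A B D C.

Variables (X : 'M[K]_(2 ^ n)) (CX : K) (M : 'M[K]_m).
Hypothesis gX : gaussian_form c X CX M.

Let aM : M^T = - M := gX.1.

Lemma gaussian_map_integral :
  gsubst (fun a : 'I_m => gvar K (theta a)) (grassmann_rep c (E X)) =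
  (C * CX) *: gderivs (int_word n) (integrand A B D M).
Proof.
rewrite EG berezin_int_word gX.2 linearZ /= -scalerAr linearZ /= scalerA.
by [].
Qed.

Lemma gaussian_map_trace :
  \tr (E X) = C * (-1) ^+ n * gpf (transfer_mx M D) * \tr X.
Proof.
rewrite trace_grassmann_rep (gaussian_form_trace gX).
rewrite -(gsubst_set0 (@theta n)) gaussian_map_integral gscaleE gaussian_integral_const.
by ring.
Qed.

Lemma gaussian_map_trace_sqr :
  (\tr (E X)) ^+ 2 = C ^+ 2 * \det (1%:M + M *m D) * (\tr X) ^+ 2.
Proof.
rewrite gaussian_map_trace -(gpf_transfer_sqr aM aD) !exprMn.
by rewrite sqrr_sign mulr1.
Qed.

Lemma gaussian_map_form : 1%:M + M *m D \in unitmx ->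
  gaussian_form c (E X) ((2 ^+ n)^-1 * \tr (E X))
    (B *m invmx (1%:M + M *m D) *m M *m B^T + A).
Proof.
move=> uMD; split; first exact: output_correlation_antisym.
apply: gsubst_theta_inj; rewrite linearZ /= gaussian_map_integral.
rewrite (gaussian_integral_form B aA aD aM uMD) scalerA; congr (_ *: _).
rewrite trace_grassmann_rep mulKf ?expf_neq0 ?pnatr_eq0 //.
by rewrite -(gsubst_set0 (@theta n)) gaussian_map_integral gscaleE.
Qed.

Lemma gaussian_map_trace_Pf : M \in unitmx ->
  \tr (E X) = C * (-1) ^+ n * Pf M * Pf (invmx M + D) * \tr X.
Proof.
by move=> uM; rewrite gaussian_map_trace !Pf_gpf (gpf_transfer D aM uM) !mulrA.
Qed.

End GaussianMap.

Lemma gaussian_map_C0 (E : {linear 'M[K]_(2 ^ n) -> 'M[K]_(2 ^ n)}) A B D X :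
  gaussian_integral_rep c E A B D 0 -> E X = 0.
Proof.
move=> EG; rewrite -(quantizeK cC (E X)).
suff -> : grassmann_rep c (E X) = 0 by rewrite linear0.
by apply: gsubst_theta_inj; rewrite EG scale0r linear0.
Qed.

Lemma correlation_inv (M D : 'M[K]_m) :
  M \in unitmx -> 1%:M + M *m D \in unitmx ->
  invmx M + D \in unitmx /\
  invmx (1%:M + M *m D) = invmx (invmx M + D) *m invmx M.
Proof.
move=> uM uMD; have E : 1%:M + M *m D = M *m (invmx M + D).
  by rewrite mulmxDr mulmxV.
have u : invmx M + D \in unitmx by move: uMD; rewrite E unitmx_mul => /andP[].
split=> //; apply: (can_inj (mulKmx uMD)); rewrite mulmxV // E.
by rewrite mulmxA mulmxK // mulmxV.
Qed.

(** The determinant is polynomial in [t] and equals 1 at 0. *)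
Lemma det_perturbation (N : 'M[K]_m) :
  exists2 p : {poly K}, p != 0 & forall t, \det (1%:M + t *: N) = p.[t].
Proof.
pose P : 'M[{poly K}]_m := 1%:M + 'X *: map_mx polyC N.
have pE t : \det (1%:M + t *: N) = (\det P).[t].
  rewrite -horner_evalE -det_map_mx; congr (\det _); apply/matrixP => i j.
  by rewrite !mxE /= /horner_eval hornerD hornerM hornerX hornerMn !hornerC.
exists (\det P) => //; apply/eqP => P0; have := pE 0.
by rewrite scale0r addr0 det1 P0 horner0 => /eqP; rewrite oner_eq0.
Qed.

(** There are finitely many roots, and an injective sequence meets each of them at most once. *)
Lemma eventually_not_root (p : {poly K}) (f : nat -> K) : p != 0 -> injective f ->
  exists N0, forall j, p.[f (j + N0)%N] != 0.
Proof.
move=> p0 injf; have [r rE] := closed_field_poly_normal p.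
have [N0 HN] : exists N0, forall j, f (j + N0)%N \notin r.
  elim: (r) => [|z s [N0 HN]]; first by exists 0%N.
  have [[k kz]|nz] := boolp.pselect (exists k, f k = z); last first.
    exists N0 => j; rewrite inE negb_or HN andbT.
    by apply/eqP => fz; apply: nz; exists (j + N0)%N.
  exists (N0 + k.+1)%N => j; rewrite inE negb_or addnCA addnC HN andbT.
  rewrite -kz; apply/eqP => /injf E.
  suff : (k < j + k.+1 + N0)%N by rewrite E ltnn.
  by rewrite addnAC leq_addl.
exists N0 => j; rewrite -rootE rE rootZ ?lead_coef_eq0 // root_prod_XsubC.
exact: HN.
Qed.

End GaussianMaps.

(** * Singular limits *)

From mathcomp Require Import complex all_classical all_reals all_analysis.
Import Order.TTheory GRing.Theory Num.Theory.
Import numFieldNormedType.Exports.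

(* The topology of Defs is canonical on an abstract numClosedFieldType but not *)
(* on the literal type R[i], so limits are taken over the former, with the     *)
(* archimedean property as a hypothesis.                                       *)
Definition small_inverses (K : numDomainType) : Prop :=
  forall e : K, 0 < e -> exists N, forall j, (N <= j)%N -> j.+1%:R^-1 < e.

Lemma complex_small_inverses (R : realType) : small_inverses R[i].
Proof.
move=> e; rewrite ltcE /= => /andP[/eqP ie re].
have [N _ HN] := near_infty_natSinv_lt (PosNum re).
exists N => j /HN /= jN.
have -> : (j.+1%:R)^-1 = ((j.+1%:R)^-1)%:C%C :> R[i].
  by rewrite fmorphV /= rmorph_nat.
by rewrite ltcE /= -ie eqxx jN.
Qed.

Section Convergence.

Variable K : numClosedFieldType.
Hypothesis K_inv : small_inverses K.

Lemma cvg_inv_succ : ((fun j => (j.+1%:R)^-1 : K) @ \oo --> (0 : K))%classic.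
Proof.
apply/cvgrPdist_lt => e /K_inv[N HN]; exists N => // j /HN jN.
by rewrite sub0r normrN normfV ger0_norm ?ler0n.
Qed.

Lemma cvg_mx_entries p q (u : nat -> 'M[K]_(p, q)) (L : 'M[K]_(p, q)) :
  (forall i j, ((fun k => u k i j) @ \oo --> L i j)%classic) -> (u @ \oo --> L)%classic.
Proof.
move=> uL; apply/cvg_ballP => e e0.
near=> k; split => // i j; move: i j; near: k.
apply: filter_forall => i; apply: filter_forall => j.
exact: (cvg_ball (uL i j)).
Unshelve. all: by end_near. Qed.

Lemma cvg_horner (p : {poly K}) (t : nat -> K) (t0 : K) :
  (t @ \oo --> t0)%classic -> ((fun j => p.[t j]) @ \oo --> p.[t0])%classic.
Proof.
move=> tt0; elim/poly_ind: p => [|p z IH].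
  by rewrite horner0; under eq_fun do rewrite horner0; exact: cvg_cst.
rewrite hornerMXaddC; under eq_fun do rewrite hornerMXaddC.
by apply: cvgD (cvg_cst _); apply: cvgM.
Qed.

Lemma cvg_poly_mx p q d (Z : nat -> 'M[K]_(p, q)) (t : nat -> K) (t0 : K) :
  (t @ \oo --> t0)%classic ->
  ((fun j => \sum_(k < d) t j ^+ k *: Z k) @ \oo --> \sum_(k < d) t0 ^+ k *: Z k)%classic.
Proof.
move=> tt0; apply: cvg_mx_entries => i j.
have pE s : (\sum_(k < d) s ^+ k *: Z k) i j = (\poly_(k < d) Z k i j).[s].
  by rewrite horner_poly summxE; apply: eq_bigr => k _; rewrite mxE mulrC.
rewrite pE; under eq_fun do rewrite pE.
exact: cvg_horner.
Qed.

End Convergence.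

Section SingularLimit.

Variables (K : numClosedFieldType) (n : nat).
Hypothesis K_inv : small_inverses K.
Local Notation m := n.*2.
Variable c : 'I_m -> 'M[K]_(2 ^ n).
Hypothesis cC : clifford_generators c.

(** The approximating operators are multiples of the identity that shrink to 0. *)
Lemma singular_gaussian0 : singular_gaussian c 0.
Proof.
split; first exact: mxtrace0.
exists (fun j => quantize c ((j.+1%:R)^-1 *: gexp ('i / 2 *: gquad (@gvar K m) 0))).
have a0 : antisymmetric_mx (0 : 'M[K]_m) by rewrite /antisymmetric_mx trmx0 oppr0.
split=> [j|].
  have gX := gaussian_form_quantize cC (j.+1%:R)^-1 a0.
  split; last by exists (j.+1%:R)^-1, 0.
  by rewrite (gaussian_form_trace cC gX) mulf_neq0 ?expf_neq0 ?invr_eq0 ?pnatr_eq0.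
apply: cvg_mx_entries => i j; under eq_fun do rewrite linearZ mxE.
have -> : (0 : 'M[K]_(2 ^ n)) i j =
    0 * quantize c (gexp ('i / 2 *: gquad (@gvar K m) 0)) i j.
  by rewrite mxE mul0r.
by apply: cvgM; [exact: cvg_inv_succ K_inv | exact: cvg_cst].
Qed.

Variables (E : {linear 'M[K]_(2 ^ n) -> 'M[K]_(2 ^ n)}) (A B D : 'M[K]_m) (C : K).
Hypotheses (aA : antisymmetric_mx A) (aD : antisymmetric_mx D).
Hypothesis EG : gaussian_integral_rep c E A B D C.
Variables (X : 'M[K]_(2 ^ n)) (CX : K) (M : 'M[K]_m).
Hypotheses (X_tr : \tr X != 0) (gX : gaussian_form c X CX M).

Lemma gaussian_map_zero_trace_singular : \tr (E X) = 0 -> singular_gaussian c (E X).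
Proof.
(* If [C] vanishes, the output is 0 for every input, so no perturbation of M could have nonzero
   trace. *)
move=> trEX; have [C0|C0] := eqVneq C 0.
  by rewrite (gaussian_map_C0 cC X (B := B) (A := A) (D := D)) -?C0 //; exact: singular_gaussian0.
split=> //.
(* The scaling factors are pairwise distinct and tend to 1; the shift by [N0] skips the finitely
   many at which I + tMD is singular. *)
pose t j : K := 1 + (j.+1%:R)^-1.
have [p p0 pE] := det_perturbation (M *m D).
have injt : injective t.
  by move=> j k /addrI/invr_inj/eqP; rewrite eqr_nat => /eqP[].
have [N0 HN] := eventually_not_root p0 injt.
pose q := 'i / 2 *: gquad (@gvar K m) M.
pose Y s := quantize c (CX *: gexp ('i / 2 *: gquad (@gvar K m) (s *: M))).
exists (fun j => E (Y (t (j + N0)%N))); split=> [j|].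
  set s := t _.
  have asM : antisymmetric_mx (s *: M) by rewrite /antisymmetric_mx linearZ /= gX.1 scalerN.
  have gY := gaussian_form_quantize cC CX asM; rewrite -/(Y s) in gY.
  have us : 1%:M + (s *: M) *m D \in unitmx.
    by rewrite -scalemxAl unitmxE unitfE pE HN.
  have trY : \tr (Y s) != 0.
    by rewrite (gaussian_form_trace cC gY) -(gaussian_form_trace cC gX).
  split; last by do 2!eexists; apply: (gaussian_map_form cC aA aD EG gY us).
  (* The squared trace is a product of nonzero factors: [C], the determinant and the trace of the
     perturbed input. *)
  rewrite -sqrf_eq0 (gaussian_map_trace_sqr cC aD EG gY).
  by rewrite !mulf_neq0 ?expf_neq0 // -unitfE -unitmxE.
pose Z k := E (quantize c (CX *: ((k`!%:R)^-1 *: q ^+ k))).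
(* The exponential is a finite sum, so the output is a polynomial in [s] with operator
   coefficients. *)
have YZ s : E (Y s) = \sum_(k < m.+1) s ^+ k *: Z k.
  rewrite /Y gquadE gformZ scalerA mulrC -scalerA -/q /gexp.
  rewrite scaler_sumr (linear_sum (quantize c)) (linear_sum E); apply: eq_bigr => k _.
  rewrite exprZn /Z -!linearZ /=; congr (E (quantize c _)).
  rewrite !scalerA; congr (_ *: _). by rewrite mulrC mulrA.
under eq_fun do rewrite YZ.
have -> : E X = \sum_(k < m.+1) 1 ^+ k *: Z k.
  by rewrite -YZ /Y scale1r -gX.2 quantizeK.
apply: cvg_poly_mx.
rewrite -[X in (_ --> X)%classic]addr0.
apply: cvgD; first exact: cvg_cst.
by have := cvg_inv_succ K_inv; rewrite -(cvg_shiftn N0).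
Qed.

End SingularLimit.

(** * The action of a Gaussian map on a Gaussian operator *)

Theorem mainTheorem3 (R : realType) (n : nat)
    (c : 'I_n.*2 -> 'M[R[i]]_(2 ^ n)) (c_clifford : clifford_generators c)
    (E : {linear 'M[R[i]]_(2 ^ n) -> 'M[R[i]]_(2 ^ n)})
    (A B D : 'M[R[i]]_n.*2) (C : R[i])
    (A_antisym : antisymmetric_mx A) (D_antisym : antisymmetric_mx D)
    (E_gaussian : gaussian_integral_rep c E A B D C)
    (X : 'M[R[i]]_(2 ^ n)) (CX : R[i]) (M : 'M[R[i]]_n.*2)
    (X_tr : \tr X != 0) (X_gaussian : gaussian_form c X CX M) :
  let EM := B *m invmx (1%:M + M *m D) *m M *m B^T + A in
  gaussian c (E X) /\
  (1%:M + M *m D \in unitmx ->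
     gaussian_form c (E X) ((2 ^+ n)^-1 * \tr (E X)) EM) /\
  (M \in unitmx -> 1%:M + M *m D \in unitmx ->
     invmx M + D \in unitmx /\ B *m invmx (invmx M + D) *m B^T + A = EM) /\
  (M \in unitmx ->
     \tr (E X) = C * (-1) ^+ n * Pf M * Pf (invmx M + D) * \tr X) /\
  (\tr (E X)) ^+ 2 = C ^+ 2 * \det (1%:M + M *m D) * (\tr X) ^+ 2 /\
  (1%:M + M *m D \notin unitmx ->
     singular_gaussian c (E X) /\
     forall CE M', gaussian_form c (E X) CE M' -> CE = 0).
Proof.
have form := gaussian_map_form c_clifford A_antisym D_antisym E_gaussian X_gaussian.
have sqr := gaussian_map_trace_sqr c_clifford D_antisym E_gaussian X_gaussian.
have singular := gaussian_map_zero_trace_singular (@complex_small_inverses R) c_clifford A_antisym D_antisym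
  E_gaussian X_tr X_gaussian.
have tr0 : 1%:M + M *m D \notin unitmx -> \tr (E X) = 0.
  rewrite unitmxE unitfE negbK => /eqP d0; apply/eqP.
  by rewrite -sqrf_eq0 sqr d0 mulr0 mul0r.
move=> EM; split; [|split; [|split; [|split; [|split]]]] => //.
(* A nonzero trace forces I + MD to be invertible, by the squared identity. *)
- have [trE|trE] := eqVneq (\tr (E X)) 0; first by right; apply: singular.
  left; split=> //; do 2!eexists; apply: form.
  by apply: contraNT trE => /tr0/eqP.
- move=> uM uMD; have [u E1] := correlation_inv uM uMD; split=> //.
  by rewrite /EM E1 -!mulmxA mulKmx.
- exact: (gaussian_map_trace_Pf c_clifford E_gaussian X_gaussian).
- move=> nu; split; first by apply: singular; apply: tr0.
  move=> CE M' gE; apply/eqP; have /eqP := tr0 nu.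
  by rewrite (gaussian_form_trace c_clifford gE) mulf_eq0 expf_eq0 pnatr_eq0 andbF.
Qed.
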